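(* If $f\in M$ has a finite asymptotic value, then $\mathcal{F}(f)$ has no Baker wandering domain. In particular, this is the case for all $f\in M_o$.
   Context: $\widehat{\mathbb{C}}=\mathbb{C}\cup\{\infty\}$. For a transcendental meromorphic $f:\mathbb{C}\to\widehat{\mathbb{C}}$, the Fatou set $\mathcal{F}(f)$ is the set of $z\in\widehat{\mathbb{C}}$ having a neighborhood on which all iterates $f^n$ are defined and form a normal family. A Fatou component is a connected component of $\mathcal{F}(f)$. For a Fatou component $U$, $U_n$ denotes the Fatou component containing $f^n(U)$, $U_0=U$. $U$ is periodic if $U_p=U$ for some natural number $p$; pre-periodic if it is not periodic but some $U_n$ is periodic; wandering if it is neither periodic nor pre-periodic. A wandering domain $U$ is called Baker wandering if for all large enough $n$, $U_n$ is bounded, multiply connected and surrounds $0$ (i.e. $0$ lies in a bounded component of the complement of $U_n$), and $U_n\to\infty$ as $n\to\infty$. A finite asymptotic value of $f$ is a point $w\in\mathbb{C}$ for which there is a path $\gamma:[0,\infty)\to\mathbb{C}$ with $\gamma(t)\to\infty$ and $f(\gamma(t))\to w$ as $t\to\infty$. $M$ is the class of transcendental meromorphic functions $f:\mathbb{C}\to\widehat{\mathbb{C}}$ having either at least two poles, or exactly one pole which is not an omitted value. $O_f$ is the set of omitted values of $f$ (values in $\widehat{\mathbb{C}}$ not taken by $f$ on $\mathbb{C}$; for $f\in M$ these are finite). $M_o=\{f\in M: O_f\neq\emptyset\}$. *)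

(* Defs.v *)
From mathcomp Require Import all_boot all_order all_algebra.
From mathcomp Require Import complex.
From mathcomp Require Import all_classical all_reals all_analysis.
Import Order.TTheory GRing.Theory Num.Theory numFieldNormedType.Exports.

Set Implicit Arguments.
Unset Strict Implicit.
Unset Printing Implicit Defensive.

Local Open Scope classical_set_scope.
Local Open Scope ring_scope.

(* R[i] packaged as a numClosedFieldType, so that the norm-induced
   topology of mathcomp-analysis is found by unification. *)
Definition cplx (R : realType) : numClosedFieldType := R[i]%C.

Notation sphere R := (one_point_compactification (cplx R)).

Section Definitions.
Variable R : realType.
Local Notation C := (cplx R).
Local Notation Chat := (sphere R).

Definition infty : Chat := None.
Definition fin (z : C) : Chat := Some z.

(* A real number seen in C, as are norms and orders on R[i]: 0 < e in C means
   that e is real and positive. *)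
Definition chordal (z w : Chat) : C :=
  match z, w with
  | Some a, Some b =>
      2 * `|a - b| / (sqrtC (1 + `|a| ^+ 2) * sqrtC (1 + `|b| ^+ 2))
  | Some a, None | None, Some a => 2 / sqrtC (1 + `|a| ^+ 2)
  | None, None => 0
  end.

(* The value 0 given to odflt is never used: differentiability is only ever
   required at all points of a (punctured) neighborhood where f is finite. *)
Definition finite_diff_at (f : C -> Chat) (z : C) : Prop :=
  f z <> infty /\ derivable (odflt 0 \o f : C -> C) z 1.

Definition meromorphic (f : C -> Chat) : Prop :=
  forall a : C,
    (\forall z \near a, finite_diff_at f z) \/
    [/\ f a = infty, \forall z \near a^', finite_diff_at f z
      & f z @[z --> a^'] --> infty].

Definition rational (f : C -> Chat) : Prop :=
  exists p q : {poly C}, [/\ q != 0, coprimep p q &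
    forall z, f z = if q.[z] == 0 then infty else fin (p.[z] / q.[z])].

Definition transcendental_meromorphic (f : C -> Chat) : Prop :=
  meromorphic f /\ ~ rational f.

Definition pole (f : C -> Chat) (a : C) : Prop := f a = infty.

Definition omitted (f : C -> Chat) : set Chat :=
  [set w | forall z, f z <> w].

Definition classM (f : C -> Chat) : Prop :=
  transcendental_meromorphic f /\
  ((exists a b, [/\ a <> b, pole f a & pole f b]) \/
   (exists a, (forall z, pole f z <-> z = a) /\ ~ omitted f (fin a))).

Definition classMo (f : C -> Chat) : Prop :=
  classM f /\ omitted f !=set0.

Definition finite_asymptotic_value (f : C -> Chat) (w : C) : Prop :=
  exists gamma : R -> C,
    [/\ {within `[0, +oo[, continuous gamma},
        fin (gamma t) @[t --> +oo%R] --> infty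
      & f (gamma t) @[t --> +oo%R] --> fin w].

(* f is not defined at infinity: iterate f n z is the n-th iterate only for z
   in iter_dom f n, and is the junk value infty elsewhere. *)
Definition iterate (f : C -> Chat) (n : nat) : Chat -> Chat :=
  iter n (fun z => if z is Some a then f a else infty).

Definition iter_dom (f : C -> Chat) (n : nat) : set Chat :=
  [set z | forall k, (k < n)%N -> iterate f k z <> infty].

Definition normal_family (D : set Chat) (G : set (Chat -> Chat)) : Prop :=
  forall u : nat -> Chat -> Chat, (forall n, G (u n)) ->
  exists (s : nat -> nat) (g : Chat -> Chat),
    {homo s : m n / (m < n)%N} /\
    forall K : set Chat, compact K -> K `<=` D ->
    forall e : C, 0 < e ->
    \forall n \near \oo, forall z, K z -> chordal (u (s n) z) (g z) < e.

Definition fatou (f : C -> Chat) : set Chat :=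
  [set z | exists D, [/\ open_nbhs z D, (forall n, D `<=` iter_dom f n)
                       & normal_family D (range (iterate f))]].

Definition fatou_component (f : C -> Chat) (U : set Chat) : Prop :=
  exists2 z, fatou f z & U = connected_component (fatou f) z.

(* The Fatou component U_n containing f^n(U); xget is a description operator,
   the component being unique when U is nonempty. *)
Definition component_iter (f : C -> Chat) (U : set Chat) (n : nat) : set Chat :=
  xget set0 [set V | fatou_component f V /\ iterate f n @` U `<=` V].

Definition periodic (f : C -> Chat) (U : set Chat) : Prop :=
  exists2 p, (0 < p)%N & component_iter f U p = U.

Definition preperiodic (f : C -> Chat) (U : set Chat) : Prop :=
  ~ periodic f U /\ exists n, periodic f (component_iter f U n).

Definition wandering (f : C -> Chat) (U : set Chat) : Prop :=
  [/\ fatou_component f U, ~ periodic f U & ~ preperiodic f U].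

Definition sphere_bounded (A : set Chat) : Prop :=
  exists2 B : set C, bounded_set B & A = fin @` B.

(* For a domain of the sphere: its complement in the sphere has at least two
   components. *)
Definition multiply_connected (U : set Chat) : Prop := ~ connected (~` U).

(* The first conjunct is needed: the connected component of a point outside
   the set is empty, hence bounded. *)
Definition surrounds0 (U : set Chat) : Prop :=
  ~ U (fin 0) /\ sphere_bounded (connected_component (~` U) (fin 0)).

Definition tends_to_infty (U : nat -> set Chat) : Prop :=
  forall W, nbhs infty W -> \forall n \near \oo, U n `<=` W.

Definition baker_wandering (f : C -> Chat) (U : set Chat) : Prop :=
  [/\ wandering f U,
      \forall n \near \oo, [/\ sphere_bounded (component_iter f U n),
        multiply_connected (component_iter f U n)
        & surrounds0 (component_iter f U n)]
    & tends_to_infty (component_iter f U)].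

End Definitions.

(* Main.v *)
(* A Baker wandering domain U would give, for large n, components U_n that
   surround 0, tend to infinity and satisfy f(U_n) <= U_{n+1}. A path from 0 to
   infinity must cross every such U_n, so f is unbounded along its end and has
   no finite limit there. If f omits w, then 1/(f - w) is arbitrarily small on
   U_n although not at a fixed point inside U_n: on a clopen piece of the
   complement of U_n its modulus has a local maximum, which contradicts the
   open mapping theorem.

   The inclusion f(U_n) <= U_{n+1} also rests on the open mapping theorem, which
   is obtained from Goursat's subdivision argument: contour integrals are
   replaced by dyadic Riemann sums, for which subdivision is an exact identity,
   so that no limit has to be known to exist. *)

Require Import Defs.
From mathcomp Require Import all_boot all_order all_algebra.
From mathcomp Require Import complex ring lra zify.
From mathcomp Require Import all_classical all_reals all_analysis.
Import Order.TTheory GRing.Theory Num.Theory numFieldNormedType.Exports.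

Set Implicit Arguments.
Unset Strict Implicit.
Unset Printing Implicit Defensive.

Local Open Scope classical_set_scope.
Local Open Scope ring_scope.

(** * Complex numbers as pairs of reals *)

(** The second claim is not deduced from the first: that an omitted value is asymptotic is a form of
    Iversen's theorem, and the local maximum argument avoids it. That argument cannot be run on the
    component of 0 in the complement of [U_n], because other components may accumulate on it and a
    maximum over it need not be local. A clopen piece has only its own points and points of [U_n]
    nearby, and it can be chosen to miss infinity because in a compact Hausdorff space a component
    is the intersection of clopen pieces. On the analytic side, the sums never get an exact value
    such as 2 pi i; they only yield a Cauchy estimate with a factor 6 instead of 1. The factor is
    harmless in both uses: the identity principle multiplies it by the N-th power of a ratio below
    1, and the open mapping theorem chooses its radius small enough to beat it. *)

Section ComplexBasics.
Variable R : realType.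
Local Notation C := (cplx R).

Definition rnorm (z : C) : R := ComplexField.Normc.normc (z : R[i]%C).
Definition mkc (x y : R) : C := (Complex x y : R[i]%C).
Definition rc (x : R) : C := mkc x 0.
Definition re (z : C) : R := complex.Re (z : R[i]%C).
Definition im (z : C) : R := complex.Im (z : R[i]%C).

Lemma normE (z : C) : `|z| = rc (rnorm z).
Proof. by []. Qed.

Lemma mkcD x y x' y' : mkc x y + mkc x' y' = mkc (x + x') (y + y').
Proof. by []. Qed.
Lemma mkcN x y : - mkc x y = mkc (- x) (- y).
Proof. by []. Qed.
Lemma mkcM x y x' y' : mkc x y * mkc x' y' = mkc (x * x' - y * y') (x * y' + y * x').
Proof. by []. Qed.
Lemma mkc_eta z : mkc (re z) (im z) = z.
Proof. by case: z. Qed.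
Lemma reD z w : re (z + w) = re z + re w.
Proof. by case: z; case: w. Qed.
Lemma imD z w : im (z + w) = im z + im w.
Proof. by case: z; case: w. Qed.
Lemma reN z : re (- z) = - re z.
Proof. by case: z. Qed.
Lemma imN z : im (- z) = - im z.
Proof. by case: z. Qed.
Lemma reM z w : re (z * w) = re z * re w - im z * im w.
Proof. by case: z; case: w. Qed.
Lemma imM z w : im (z * w) = re z * im w + im z * re w.
Proof. by case: z; case: w. Qed.

Lemma rcD x y : rc (x + y) = rc x + rc y.
Proof. by rewrite /rc mkcD addr0. Qed.
Lemma rcN x : rc (- x) = - rc x.
Proof. by rewrite /rc mkcN oppr0. Qed.
Lemma rcM x y : rc (x * y) = rc x * rc y.
Proof. by rewrite /rc mkcM !mulr0 mul0r subr0 addr0. Qed.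
Lemma rc0 : rc 0 = 0. Proof. by []. Qed.
Lemma rc1 : rc 1 = 1. Proof. by []. Qed.
Lemma ler_rc x y : (rc x <= rc y) = (x <= y).
Proof. exact: lecR. Qed.
Lemma ltr_rc x y : (rc x < rc y) = (x < y).
Proof. exact: ltcR. Qed.
Lemma gt0_rc (e : C) : 0 < e -> e = rc (re e) /\ 0 < re e.
Proof.
case: e => a b /=; rewrite ltcE /= => /andP[/eqP b0 a0].
by have -> : b = 0 := b0.
Qed.

Lemma rcI : injective rc. Proof. by move=> x y []. Qed.

Lemma rnorm_ge0 z : 0 <= rnorm z.
Proof. by rewrite -ler_rc -normE normr_ge0. Qed.
Lemma rnorm0 : rnorm 0 = 0.
Proof. by apply: rcI; rewrite -normE normr0. Qed.
Lemma rnorm1 : rnorm 1 = 1.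
Proof. by apply: rcI; rewrite -normE normr1. Qed.
Lemma rnorm_eq0 z : (rnorm z == 0) = (z == 0).
Proof.
apply/eqP/eqP => [h|->]; last exact: rnorm0.
by apply/eqP; rewrite -normr_eq0 normE h.
Qed.
Lemma rnorm_gt0 z : (0 < rnorm z) = (z != 0).
Proof. by rewrite lt0r rnorm_eq0 rnorm_ge0 andbT. Qed.
Lemma rnormM z w : rnorm (z * w) = rnorm z * rnorm w.
Proof. by apply: rcI; rewrite rcM -!normE normrM. Qed.
Lemma rnormV z : rnorm z^-1 = (rnorm z)^-1.
Proof. exact: ComplexField.Normc.normcV. Qed.
Lemma rnormX z n : rnorm (z ^+ n) = rnorm z ^+ n.
Proof. by elim: n => [|n IH]; rewrite ?rnorm1 // !exprS rnormM IH. Qed.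
Lemma rnormD z w : rnorm (z + w) <= rnorm z + rnorm w.
Proof. by rewrite -ler_rc rcD -!normE ler_normD. Qed.
Lemma rnormN z : rnorm (- z) = rnorm z.
Proof. by apply: rcI; rewrite -!normE normrN. Qed.
Lemma rnormB z w : rnorm (z - w) = rnorm (w - z).
Proof. by rewrite -opprB rnormN. Qed.
Lemma rnorm_triangle y x z : rnorm (x - z) <= rnorm (x - y) + rnorm (y - z).
Proof. by have := rnormD (x - y) (y - z); rewrite addrA subrK. Qed.
Lemma rnormBl z w : rnorm z - rnorm w <= rnorm (z - w).
Proof. by rewrite lerBlDr; have := rnormD (z - w) w; rewrite subrK. Qed.
Lemma rnorm_rc x : rnorm (rc x) = `|x|.
Proof. by rewrite /rnorm /= expr0n /= addr0 sqrtr_sqr. Qed.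
Lemma rnorm_sqr z : rnorm z ^+ 2 = re z ^+ 2 + im z ^+ 2.
Proof.
by case: z => a b; rewrite /rnorm /= sqr_sqrtr // addr_ge0 // sqr_ge0.
Qed.
Lemma re_le_rnorm z : `|re z| <= rnorm z.
Proof.
by rewrite -ler_sqr ?nnegrE ?normr_ge0 ?rnorm_ge0 // rnorm_sqr real_normK
  ?num_real // lerDl sqr_ge0.
Qed.
Lemma im_le_rnorm z : `|im z| <= rnorm z.
Proof.
by rewrite -ler_sqr ?nnegrE ?normr_ge0 ?rnorm_ge0 // rnorm_sqr real_normK
  ?num_real // lerDr sqr_ge0.
Qed.
Lemma rnorm_le z : rnorm z <= `|re z| + `|im z|.
Proof.
rewrite -ler_sqr ?nnegrE ?addr_ge0 ?normr_ge0 ?rnorm_ge0 // rnorm_sqr.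
by rewrite sqrrD !real_normK ?num_real // addrAC lerDl mulrn_wge0 // mulr_ge0.
Qed.
Lemma cnbhsP (a : C) (P : set C) : nbhs a P <->
  exists2 e : R, 0 < e & forall z, rnorm (z - a) < e -> P z.
Proof.
split.
  move/nbhs_ballP => [e /= e0 aP].
  have [ee re0] := gt0_rc e0.
  exists (re e) => // z za; apply: aP; rewrite -ball_normE /=.
  by rewrite ee normE ltr_rc rnormB.
move=> [e e0 aP]; apply/nbhs_ballP; exists (rc e); first by rewrite /= -rc0 ltr_rc.
move=> z; rewrite -ball_normE /= normE ltr_rc rnormB; exact: aP.
Qed.

Lemma cdnbhsP (a : C) (P : set C) : a^' P <->
  exists2 e : R, 0 < e & forall z, rnorm (z - a) < e -> z != a -> P z.
Proof.
split.
  by move/cnbhsP=> [e e0 h]; exists e => // z za zna; exact: (h z za zna).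
by move=> [e e0 h]; apply/cnbhsP; exists e => // z za zna; exact: (h z za zna).
Qed.

Lemma ccvgP (T : Type) (F : set_system T) (FF : Filter F) (f : T -> C) (l : C) :
  f @ F --> l <-> forall e : R, 0 < e -> F [set x | rnorm (f x - l) < e].
Proof.
split.
  by move=> h e e0; apply: (h [set z | rnorm (z - l) < e]); apply/cnbhsP; exists e.
move=> h P /cnbhsP[e e0 lP]; exact: (@filterS _ F FF _ _ (fun x => lP (f x)) (h e e0)).
Qed.

(** Clearing the denominator makes the estimate hold at [z = a] too; [goursat] and [weak_cauchy] use
    the derivative in this form. *)
Lemma cderivableP (f : C -> C) (a : C) : derivable f a 1 <->
  exists l : C, forall e : R, 0 < e -> exists2 d : R, 0 < d &
    forall z, rnorm (z - a) < d ->
      rnorm (f z - f a - l * (z - a)) <= e * rnorm (z - a).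
Proof.
split.
  move=> /cvg_ex[/= l]; move/(ccvgP _) => h; exists l => e e0.
  have /cdnbhsP[d d0 {}h] := h e e0.
  exists d => // z zd; have [->|zna] := eqVneq z a.
    by rewrite !subrr mulr0 subr0 rnorm0 mulr0.
  have za0 : z - a != 0 by rewrite subr_eq0.
  have := h (z - a); rewrite subr0 => /(_ zd za0) /=.
  rewrite /GRing.scale /= mulr1 subrK => {}h.
  have -> : f z - f a - l * (z - a) = ((z - a)^-1 * (f z - f a) - l) * (z - a).
    by rewrite mulrBl mulrAC mulVf // mul1r.
  by rewrite rnormM ler_wpM2r ?rnorm_ge0 // ltW.
move=> [l h]; apply/cvg_ex; exists l; apply/(ccvgP _) => e e0.
(* Half of [e] turns the non-strict bound into a strict one. *)
have [d d0 {}h] := h (e / 2) (divr_gt0 e0 (ltr0Sn _ _)).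
apply/cdnbhsP; exists d => // z; rewrite subr0 => zd z0 /=.
rewrite /GRing.scale /= mulr1.
have := h (z + a); rewrite addrK => /(_ zd) {}h.
rewrite -(ltr_pM2r (_ : 0 < rnorm z)) ?rnorm_gt0 // -rnormM.
have -> : (z^-1 * (f (z + a) - f a) - l) * z = f (z + a) - f a - l * z.
  by rewrite mulrBl mulrAC mulVf // mul1r.
apply: (le_lt_trans h); rewrite ltr_pM2r ?rnorm_gt0 //.
by rewrite ltr_pdivrMr // ltr_pMr // ltr1n.
Qed.

Lemma cderivable_continuous (f : C -> C) (a : C) : derivable f a 1 ->
  {for a, continuous f}.
Proof. by move/derivable1_diffP/differentiable_continuous. Qed.

End ComplexBasics.

(** * Dyadic contour sums *)

Section Cauchy.
Variable R : realType.
Local Notation C := (cplx R).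
Implicit Types (p z w v : C) (s t : R) (f g : C -> C).

Definition ii (s : R) : C := mkc 0 s.

Lemma iiD s t : ii (s + t) = ii s + ii t.
Proof. by rewrite /ii mkcD addr0. Qed.
Lemma rnorm_ii s : rnorm (ii s) = `|s|.
Proof. by rewrite /rnorm /= expr0n /= add0r sqrtr_sqr. Qed.

(* Left-endpoint Riemann sum of [f] along [p, p + v] with [2 ^ n] steps. *)
Fixpoint seg (n : nat) (p v : C) (f : C -> C) : C :=
  if n is m.+1 then seg m p (v / 2) f + seg m (p + v / 2) (v / 2) f
  else f p * v.

(** All four sides run in the increasing direction and two are subtracted: reversing a left-endpoint
    sum would move its sample points. *)
Definition loop (n : nat) (p : C) (s : R) (f : C -> C) : C :=
  seg n p (rc s) f + seg n (p + rc s) (ii s) f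
  - seg n (p + ii s) (rc s) f - seg n p (ii s) f.

Lemma half2 (K : numFieldType) (x : K) : (x + x) / 2 = x.
Proof. by field. Qed.

Lemma rc_half s : rc s = rc (s / 2) + rc (s / 2).
Proof. by rewrite -rcD -splitr. Qed.
Lemma ii_half s : ii s = ii (s / 2) + ii (s / 2).
Proof. by rewrite -iiD -splitr. Qed.

(** Each inner edge occurs twice, with opposite signs and the same sample points, so it cancels for
    every [n]. *)
Lemma loopS n p s f : loop n.+1 p s f =
  loop n p (s / 2) f + loop n (p + rc (s / 2)) (s / 2) f
  + loop n (p + ii (s / 2)) (s / 2) f
  + loop n (p + rc (s / 2) + ii (s / 2)) (s / 2) f.
Proof.
rewrite /loop /= (rc_half s) (ii_half s) !half2 !addrA.
set h := rc _; set k := ii _.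
rewrite (_ : p + h + k + h = p + h + h + k); last by ring.
rewrite (_ : p + k + h = p + h + k); last by ring.
rewrite (_ : p + k + k + h = p + h + k + k); last by ring.
ring.
Qed.

Lemma segD n p v f g : seg n p v (fun z => f z + g z) = seg n p v f + seg n p v g.
Proof.
by elim: n p v => [|n IH] p v /=; [rewrite mulrDl | rewrite !IH addrACA].
Qed.

Lemma segZ n p v c f : seg n p v (fun z => c * f z) = c * seg n p v f.
Proof.
by elim: n p v => [|n IH] p v /=; [rewrite mulrA | rewrite !IH mulrDr].
Qed.

Lemma loopD n p s f g : loop n p s (fun z => f z + g z) = loop n p s f + loop n p s g.
Proof. by rewrite /loop !segD; ring. Qed.

Lemma loopZ n p s c f : loop n p s (fun z => c * f z) = c * loop n p s f.
Proof. by rewrite /loop !segZ; ring. Qed.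

(** [th] replaces the factor 1/2 of the exact integral and depends on [n] alone, so its
    contributions to opposite sides of a square cancel in [loop_affine]. *)
Lemma seg_affine n : exists th : C, forall p v a b,
  seg n p v (fun z => a + b * z) = a * v + b * (v * p + v ^+ 2 * th).
Proof.
elim: n => [|n [th IH]]; first by exists 0 => p v a b /=; ring.
by exists (1 / 4 + th / 2) => p v a b /=; rewrite !IH; field.
Qed.

Lemma loop_affine n p s a b : loop n p s (fun z => a + b * z) = 0.
Proof. by have [th h] := seg_affine n; rewrite /loop !h; ring. Qed.

Lemma seg_le n p v f (M : R) :
  (forall t, 0 <= t <= 1 -> rnorm (f (p + rc t * v)) <= M) ->
  rnorm (seg n p v f) <= M * rnorm v.
Proof.
elim: n p v => [|n IH] p v h /=.
  rewrite rnormM ler_wpM2r ?rnorm_ge0 //=.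
  by have := h 0; rewrite rc0 mul0r addr0 lexx ler01; apply.
have rc2 t : rc t * (v / 2) = rc (t / 2) * v.
  rewrite (_ : rc t = rc (t / 2) + rc (t / 2)) ?mulrDl; last by rewrite -rcD -splitr.
  by rewrite -mulrDr -splitr.
have v2 : rnorm (v / 2) = rnorm v / 2.
  rewrite rnormM; congr (_ * _).
  by rewrite rnormV -[2 : C](rcD 1 1) rnorm_rc gtr0_norm // ltr0Sn.
have h1 : rnorm (seg n p (v / 2) f) <= M * rnorm (v / 2).
  by apply: IH => t /andP[t0 t1]; rewrite rc2; apply: h; lra.
have h2 : rnorm (seg n (p + v / 2) (v / 2) f) <= M * rnorm (v / 2).
  apply: IH => t /andP[t0 t1]; rewrite rc2.
  have -> : v / 2 = rc (1 / 2) * v.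
    by rewrite -rc2 rc1 mul1r.
  by rewrite -addrA -mulrDl -rcD; apply: h; lra.
apply: (le_trans (rnormD _ _)); rewrite v2 in h1 h2; lra.
Qed.

Lemma seg_im_ge n p v f (m : R) :
  (forall t, 0 <= t <= 1 -> m <= im (f (p + rc t * v) * v)) ->
  m <= im (seg n p v f).
Proof.
elim: n p v m => [|n IH] p v m h /=.
  by have := h 0; rewrite rc0 mul0r addr0 lexx ler01; apply.
have rc2 t : rc t * (v / 2) = rc (t / 2) * v.
  rewrite (_ : rc t = rc (t / 2) + rc (t / 2)) ?mulrDl; last by rewrite -rcD -splitr.
  by rewrite -mulrDr -splitr.
have im2 z : im (z * (v / 2)) = im (z * v) / 2.
  have -> : z * v = z * (v / 2) + z * (v / 2) by rewrite -mulrDr -splitr.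
  by rewrite imD half2.
have h1 : m / 2 <= im (seg n p (v / 2) f).
  apply: IH => t /andP[t0 t1]; rewrite rc2 im2.
  suff : m <= im (f (p + rc (t / 2) * v) * v) by lra.
  by apply: h; lra.
have h2 : m / 2 <= im (seg n (p + v / 2) (v / 2) f).
  apply: IH => t /andP[t0 t1]; rewrite rc2 im2.
  have -> : v / 2 = rc (1 / 2) * v.
    by rewrite -rc2 rc1 mul1r.
  rewrite -addrA -mulrDl -rcD.
  suff : m <= im (f (p + rc (1 / 2 + t / 2) * v) * v) by lra.
  by apply: h; lra.
by rewrite imD; lra.
Qed.

Definition square p s : set C :=
  [set z | (re p <= re z <= re p + s) && (im p <= im z <= im p + s)].

Definition square_bd p s : set C :=
  [set z | square p s z /\
    [|| re z == re p, re z == re p + s, im z == im p | im z == im p + s]].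

Lemma re_rc t : re (rc t) = t. Proof. by []. Qed.
Lemma im_rc t : im (rc t) = 0. Proof. by []. Qed.
Lemma re_ii t : re (ii t) = 0. Proof. by []. Qed.
Lemma im_ii t : im (ii t) = t. Proof. by []. Qed.

Definition reimE := (reD, imD, reN, imN, reM, imM, re_rc, im_rc, re_ii, im_ii).

Lemma loop_le n p s f (M : R) : 0 <= s ->
  (forall z, square_bd p s z -> rnorm (f z) <= M) ->
  rnorm (loop n p s f) <= 4 * s * M.
Proof.
move=> s0 h.
have e1 : rnorm (rc s) = s by rewrite rnorm_rc ger0_norm.
have e2 : rnorm (ii s) = s by rewrite rnorm_ii ger0_norm.
have b t : 0 <= t <= 1 -> 0 <= t * s <= s.
  by move=> /andP[t0 t1]; rewrite mulr_ge0 //= -[leRHS]mul1r ler_wpM2r.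
have h1 : rnorm (seg n p (rc s) f) <= M * s.
  rewrite -[X in _ * X]e1; apply: seg_le => t /b tb; apply: h; split.
    by rewrite /square /= !reimE; lra.
  by apply/or4P; constructor 3; rewrite !reimE; lra.
have h2 : rnorm (seg n (p + rc s) (ii s) f) <= M * s.
  rewrite -[X in _ * X]e2; apply: seg_le => t /b tb; apply: h; split.
    by rewrite /square /= !reimE; lra.
  by apply/or4P; constructor 2; rewrite !reimE; lra.
have h3 : rnorm (seg n (p + ii s) (rc s) f) <= M * s.
  rewrite -[X in _ * X]e1; apply: seg_le => t /b tb; apply: h; split.
    by rewrite /square /= !reimE; lra.
  by apply/or4P; constructor 4; rewrite !reimE; lra.
have h4 : rnorm (seg n p (ii s) f) <= M * s.
  rewrite -[X in _ * X]e2; apply: seg_le => t /b tb; apply: h; split.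
    by rewrite /square /= !reimE; lra.
  by apply/or4P; constructor 1; rewrite !reimE; lra.
rewrite /loop.
set a := seg n p (rc s) f in h1 *; set b1 := seg _ _ _ _ in h2 *.
set c := seg _ _ _ _ in h3 *; set d := seg _ _ _ _ in h4 *.
have := rnormD (a + b1 - c) (- d); have := rnormD (a + b1) (- c).
have := rnormD a b1; rewrite !rnormN; lra.
Qed.

End Cauchy.

(** * Goursat's theorem for dyadic sums, with and without an exceptional point *)

Section Goursat.
Variable R : realType.
Local Notation C := (cplx R).
Implicit Types (p z w v : C) (s t : R) (f g : C -> C).

Lemma expr_small (a q e : R) : `|q| < 1 -> 0 < e -> exists k, a * q ^+ k < e.
Proof.
move=> q1 e0.
have : (fun k : nat => a * q ^+ k) @ \oo --> a * 0 by apply: cvgMr; exact: cvg_expr.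
rewrite mulr0 => /(_ [set r | r < e]) [|k _ hk].
  apply/nbhs_ballP; exists e => // r; rewrite -ball_normE /= sub0r normrN.
  exact/le_lt_trans/ler_norm.
by exists k; exact: hk (leqnn _).
Qed.

Lemma nested_halving (u : nat -> R) (s : R) :
  (forall k, u k <= u k.+1 <= u k + s / 2 ^+ k.+1) ->
  exists x, forall k, u k <= x <= u k + s / 2 ^+ k.
Proof.
move=> h.
have half k : s / 2 ^+ k = s / 2 ^+ k.+1 + s / 2 ^+ k.+1.
  by rewrite exprS; field; rewrite expf_neq0 // pnatr_eq0.
have mono k j : u k <= u (k + j)%N /\ u (k + j)%N + s / 2 ^+ (k + j) <= u k + s / 2 ^+ k.
  elim: j => [|j [IH1 IH2]]; first by rewrite addn0.
  rewrite addnS; have := h (k + j)%N; have := half (k + j)%N; lra.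
have s0 k : 0 <= s / 2 ^+ k.
  case: k => [|k]; last by have := h k; lra.
  by have := h 0; have := half 0; lra.
have ub k : ubound (range u) (u k + s / 2 ^+ k).
  move=> _ [m _ <-]; case: (leqP k m) => [km|/ltnW mk].
    by have := mono k (m - k)%N; rewrite subnKC //; have := s0 m; lra.
  by have := mono m (k - m)%N; rewrite subnKC //; have := s0 k; lra.
exists (sup (range u)) => k; apply/andP; split.
  apply: ub_le_sup; last by exists k.
  by exists (u 0 + s / 2 ^+ 0).
by apply: ge_sup; [exists (u 0); exists 0%N | exact: ub].
Qed.

Definition quarter p s q : Prop :=
  [\/ q = p, q = p + rc (s / 2), q = p + ii (s / 2)
    | q = p + rc (s / 2) + ii (s / 2)].

Lemma quarter_subset p s q : 0 <= s -> quarter p s q ->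
  square q (s / 2) `<=` square p s.
Proof.
by move=> s0 [] -> z; rewrite /square /= ?reimE; lra.
Qed.

(** Compactness by bisection: were [P p0 s0] false, nested quarters without [P] would shrink to a
    point, where the local hypothesis applies. It serves Goursat's theorem and, in [open_mapping], a
    positive lower bound on the boundary of a square. *)
Lemma square_induction (P : C -> R -> Prop) p0 s0 : 0 < s0 ->
  (forall p s, 0 < s -> (forall q, quarter p s q -> P q (s / 2)) -> P p s) ->
  (forall z, square p0 s0 z -> exists2 d : R, 0 < d & forall p s, 0 < s < d ->
    square p s z -> square p s `<=` square p0 s0 -> P p s) ->
  P p0 s0.
Proof.
move=> s00 Pq Pl; apply: contrapT => nP.
have ch (ps : C * R) : exists q, 0 < ps.2 -> ~ P ps.1 ps.2 ->
    quarter ps.1 ps.2 q /\ ~ P q (ps.2 / 2).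
  case: ps => p s /=; apply: contrapT => /forallNP hn.
  have sp : 0 < s by apply: contrapT => sn; apply: (hn p).
  have nPp : ~ P p s by move=> Pp; apply: (hn p).
  apply: nPp; apply: (Pq _ _ sp) => q qq; apply: contrapT => nPqq.
  by apply: (hn q).
have [phi phiP] := choice ch.
pose sk k := s0 / 2 ^+ k.
have sk0 k : 0 < sk k by rewrite /sk divr_gt0 // exprn_gt0.
have skS k : sk k.+1 = sk k / 2.
  by rewrite /sk exprS; field; rewrite expf_neq0 // pnatr_eq0.
pose pk := fix pk k := if k is k'.+1 then phi (pk k', sk k') else p0.
have nPk k : ~ P (pk k) (sk k).
  elim: k => [|k IH]; first by rewrite /sk expr0 divr1.
  by have [_ h] := phiP (pk k, sk k) (sk0 k) IH; rewrite skS.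
have qk k : quarter (pk k) (sk k) (pk k.+1).
  by have [h _] := phiP (pk k, sk k) (sk0 k) (nPk k).
have sub0 k : square (pk k) (sk k) `<=` square p0 s0.
  elim: k => [|k IH]; first by rewrite /sk expr0 divr1.
  apply: subset_trans IH; rewrite skS; apply: quarter_subset => //.
  exact/ltW/sk0.
have [x xP] : exists x, forall k, re (pk k) <= x <= re (pk k) + sk k.
  apply: nested_halving => k; rewrite -/(sk k.+1) skS; have := sk0 k.
  by have [] := qk k; move=> ->; rewrite ?reimE; lra.
have [y yP] : exists y, forall k, im (pk k) <= y <= im (pk k) + sk k.
  apply: nested_halving => k; rewrite -/(sk k.+1) skS; have := sk0 k.
  by have [] := qk k; move=> ->; rewrite ?reimE; lra.
have zk k : square (pk k) (sk k) (mkc x y) by apply/andP; split.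
have [d d0 dP] := Pl _ (sub0 0 _ (zk 0)).
have [k kd] : exists k, sk k < d.
  have [|k hk] := @expr_small s0 2^-1 d _ d0; last by exists k; rewrite /sk -exprVn.
  by rewrite ger0_norm ?invr_ge0 // invf_lt1 // ltr1n.
by apply: (nPk k); apply: dP => //; rewrite sk0.
Qed.

Lemma square_rnorm p s z w : square p s z -> square p s w ->
  rnorm (z - w) <= 2 * s.
Proof.
move=> zs ws; apply: (le_trans (rnorm_le _)); rewrite ?reimE.
have h1 : `|re z - re w| <= s.
  by move: zs ws; rewrite /square /= ler_norml; lra.
have h2 : `|im z - im w| <= s.
  by move: zs ws; rewrite /square /= ler_norml; lra.
by have := lerD h1 h2; rewrite (_ : s + s = 2 * s); [exact|ring].
Qed.

Lemma goursat p0 s0 f : 0 < s0 ->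
  (forall z, square p0 s0 z -> derivable f z 1) ->
  forall e : R, 0 < e -> exists N, forall n, (N <= n)%N ->
    rnorm (loop n p0 s0 f) <= e.
Proof.
move=> s00 fd e e0.
(* The bound [c * s ^+ 2] is proportional to the area, hence additive over quarters; this choice of
   [c] leaves [e / 2] for each of the two terms. *)
suff /(_ (e / (2 * s0 ^+ 2))) H : forall c : R, 0 < c -> forall eta : R, 0 < eta ->
    exists N, forall n, (N <= n)%N -> rnorm (loop n p0 s0 f) <= c * s0 ^+ 2 + eta.
  have s2 : 0 < 2 * s0 ^+ 2 by rewrite mulr_gt0 // exprn_gt0.
  have [||N hN] := H _ (e / 2); rewrite ?divr_gt0 //.
  exists N => n /hN; suff -> : e / (2 * s0 ^+ 2) * s0 ^+ 2 = e / 2 by lra.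
  by field; rewrite gt_eqF.
move=> c c0.
apply: (square_induction (P := fun p s => forall eta : R, 0 < eta ->
    exists N, forall n, (N <= n)%N -> rnorm (loop n p s f) <= c * s ^+ 2 + eta)).
- by [].
- move=> p s sp hq eta eta0.
  have e4 : 0 < eta / 4 by rewrite divr_gt0.
  have [N1 h1] := hq _ (Or41 _ _ _ (erefl _)) _ e4.
  have [N2 h2] := hq _ (Or42 _ _ _ (erefl _)) _ e4.
  have [N3 h3] := hq _ (Or43 _ _ _ (erefl _)) _ e4.
  have [N4 h4] := hq _ (Or44 _ _ _ (erefl _)) _ e4.
  exists (N1 + N2 + N3 + N4).+1 => -[//|n] nN.
  rewrite loopS.
  have {}h1 := h1 n ltac:(clear -nN; lia); have {}h2 := h2 n ltac:(clear -nN; lia).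
  have {}h3 := h3 n ltac:(clear -nN; lia); have {}h4 := h4 n ltac:(clear -nN; lia).
  set a := loop n p _ _ in h1 *; set b := loop n _ _ _ in h2 *.
  set a3 := loop n _ _ _ in h3 *; set a4 := loop n _ _ _ in h4 *.
  have := rnormD (a + b + a3) a4; have := rnormD (a + b) a3; have := rnormD a b.
  have -> : c * s ^+ 2 = c * (s / 2) ^+ 2 * 4 by field.
  lra.
- move=> z zs.
  have [l hl] := (cderivableP _ _).1 (fd z zs).
  (* Points of a square of side [s] through [z] are within [2 * s] of [z] and the perimeter is
     [4 * s], so [c / 8] gives [4 * s * (c / 8 * (2 * s)) = c * s ^+ 2]. *)
  have [d d0 hd] := hl (c / 8) ltac:(lra).
  exists (d / 2); first lra.
  move=> p s /andP[sp sd] zps _ eta eta0; exists 0%N => n _.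
  (* Only the remainder of the first-order expansion counts: affine functions have loop sum 0. *)
  have -> : f = fun w => (f z - l * z + l * w) + (f w - f z - l * (w - z)).
    by apply/funext => w; ring.
  rewrite loopD loop_affine add0r.
  suff : rnorm (loop n p s (fun w => f w - f z - l * (w - z))) <=
      4 * s * (c / 8 * (2 * s)) by nra.
  apply: loop_le; first lra.
  move=> w [ws _]; have wz := square_rnorm ws zps.
  apply: (le_trans (hd w _)); first lra.
  by rewrite ler_wpM2l //; lra.
Qed.

(* A point that never lies on a dyadic grid line of the square: after two
   subdivisions it is again the [third] of the subsquare that contains it. *)
Definition third p s : C := p + rc (s / 3) + ii (s / 3).

(** At [third p s] derivability is replaced by boundedness nearby. All but one of the pieces of a
    double subdivision fall under [goursat]; the remaining one has a quarter of the side, and after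
    [k] rounds its sum is bounded by its perimeter times [M]. *)
Lemma goursat_third k : forall p s f (M d : R), 0 < s -> 0 <= M ->
  (forall z, square p s z -> z <> third p s -> derivable f z 1) ->
  (forall z, rnorm (z - third p s) < d -> rnorm (f z) <= M) ->
  2 * (s / 4 ^+ k) < d ->
  forall eta : R, 0 < eta -> exists N, forall n, (N <= n)%N ->
    rnorm (loop n p s f) <= 4 * (s / 4 ^+ k) * M + eta.
Proof.
elim: k => [|k IH] p s f M d s0 M0 fd fM sd eta eta0.
  exists 0%N => n _; rewrite expr0 divr1 in sd *.
  suff : rnorm (loop n p s f) <= 4 * s * M by lra.
  apply: loop_le => [|z [zs _]]; first exact: ltW.
  apply: fM; apply: le_lt_trans sd; apply: (square_rnorm zs).
  by rewrite /square /third /= ?reimE; lra.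
have t4 : third (p + rc (s / 4) + ii (s / 4)) (s / 4) = third p s.
  rewrite /third.
  have -> : rc (s / 3) = rc (s / 4) + rc (s / 4 / 3).
    by rewrite -rcD; congr rc; field.
  have -> : ii (s / 3) = ii (s / 4) + ii (s / 4 / 3).
    by rewrite -iiD; congr ii; field.
  by ring.
have k4 : s / 4 ^+ k.+1 = s / 4 / 4 ^+ k.
  by rewrite exprS; field; rewrite expf_neq0 // pnatr_eq0.
(* There are seven pieces: four of side [s / 4], one of them around [third p s], and three of side
   [s / 2]. *)
have e7 : 0 < eta / 7 by rewrite divr_gt0.
have s4 : 0 < s / 4 by rewrite divr_gt0.
have s2 : 0 < s / 2 by rewrite divr_gt0.
have G q t : 0 < t -> square q t `<=` square p s -> ~ square q t (third p s) ->
    exists N, forall n, (N <= n)%N -> rnorm (loop n q t f) <= eta / 7.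
  move=> t0 qs qn; apply: goursat => // z zq; apply: fd; first exact: qs.
  by move=> zt; apply: qn; rewrite -zt.
have [||||N hN] := IH (p + rc (s / 4) + ii (s / 4)) (s / 4) f M d _ M0 _ _ _ (eta / 7) e7.
- by [].
- move=> z zs; rewrite t4; apply: fd; move: zs.
  by rewrite /square /= ?reimE; lra.
- by rewrite t4.
- by rewrite -k4.
have sq4 : s / 2 / 2 = s / 4 by field.
have [N1 h1] : exists N, forall n, (N <= n)%N -> rnorm (loop n p (s / 4) f) <= eta / 7.
  by apply: G => //; [move=> z|]; rewrite /square /third /= ?reimE; lra.
have [N2 h2] : exists N, forall n, (N <= n)%N ->
    rnorm (loop n (p + rc (s / 4)) (s / 4) f) <= eta / 7.
  by apply: G => //; [move=> z|]; rewrite /square /third /= ?reimE; lra.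
have [N3 h3] : exists N, forall n, (N <= n)%N ->
    rnorm (loop n (p + ii (s / 4)) (s / 4) f) <= eta / 7.
  by apply: G => //; [move=> z|]; rewrite /square /third /= ?reimE; lra.
have [N4 h4] : exists N, forall n, (N <= n)%N ->
    rnorm (loop n (p + rc (s / 2)) (s / 2) f) <= eta / 7.
  by apply: G => //; [move=> z|]; rewrite /square /third /= ?reimE; lra.
have [N5 h5] : exists N, forall n, (N <= n)%N ->
    rnorm (loop n (p + ii (s / 2)) (s / 2) f) <= eta / 7.
  by apply: G => //; [move=> z|]; rewrite /square /third /= ?reimE; lra.
have [N6 h6] : exists N, forall n, (N <= n)%N ->
    rnorm (loop n (p + rc (s / 2) + ii (s / 2)) (s / 2) f) <= eta / 7.
  by apply: G => //; [move=> z|]; rewrite /square /third /= ?reimE; lra.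
(* Two subdivisions use up two levels: the pieces of side [s / 4] are met at level [n], those of
   side [s / 2] at level [n.+1]. *)
exists (N + N1 + N2 + N3 + N4 + N5 + N6).+2 => -[//|[//|n]] nN.
rewrite loopS (loopS _ p) !sq4.
have {}h1 := h1 n ltac:(clear -nN; lia); have {}h2 := h2 n ltac:(clear -nN; lia).
have {}h3 := h3 n ltac:(clear -nN; lia); have {}h4 := h4 n.+1 ltac:(clear -nN; lia).
have {}h5 := h5 n.+1 ltac:(clear -nN; lia); have {}h6 := h6 n.+1 ltac:(clear -nN; lia).
have {}hN := hN n ltac:(clear -nN; lia); rewrite -k4 in hN.
set a := loop n _ _ _ in hN *; set a1 := loop n _ _ _ in h1 *.
set a2 := loop n _ _ _ in h2 *; set a3 := loop n _ _ _ in h3 *.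
set a4 := loop _ _ _ _ in h4 *; set a5 := loop _ _ _ _ in h5 *.
set a6 := loop _ _ _ _ in h6 *.
have := rnormD (a1 + a2 + a3 + a + a4 + a5) a6.
have := rnormD (a1 + a2 + a3 + a + a4) a5.
have := rnormD (a1 + a2 + a3 + a) a4.
have := rnormD (a1 + a2 + a3) a.
have := rnormD (a1 + a2) a3.
have := rnormD a1 a2.
lra.
Qed.

End Goursat.

(** * A winding number bound and a Cauchy estimate *)

Section MaximumPrinciple.
Variable R : realType.
Local Notation C := (cplx R).
Implicit Types (p z w v : C) (s t : R) (f g : C -> C).

Lemma imV z : im z^-1 = - im z / rnorm z ^+ 2.
Proof. by rewrite rnorm_sqr; case: z => a b; rewrite /= mulNr. Qed.

Lemma cderivableM f g z : derivable f z 1 -> derivable g z 1 ->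
  derivable (fun w => f w * g w : C) z 1.
Proof.
move=> df dg; have -> : (fun w => f w * g w : C) = f * g by apply/funext.
exact: (derivableM df dg).
Qed.

Lemma cderivableB f z c : derivable f z 1 -> derivable (fun w => f w - c : C) z 1.
Proof.
move=> df; have -> : (fun w => f w - c : C) = f - cst c by apply/funext.
exact: (derivableB df (derivable_cst _ _ _)).
Qed.

Lemma cderivableV f z : derivable f z 1 -> f z != 0 ->
  derivable (fun w => (f w)^-1 : C) z 1.
Proof. by move=> df fz; exact: (derivableV fz df). Qed.

Lemma cderivable_subV z b : z != b -> derivable (fun w => (w - b)^-1 : C) z 1.
Proof.
move=> zb; apply: (@cderivableV (fun w => w - b)); last by rewrite subr_eq0.
by apply: cderivableB; exact: derivable_id.
Qed.

(** A substitute for the value 2 pi i of the integral of [1 / (z - b)]. The imaginary part of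
    [v / (z - b)] is a cross product divided by [|z - b|^2], which is at most [s ^+ 2]. A side at
    distance [d] from [b] thus contributes at least [d / s], and the distances [s / 3], [2 s / 3],
    [2 s / 3], [s / 3] add up to [2 s]. *)
Lemma im_loop_third n p s : 0 < s ->
  2 <= im (loop n p s (fun z => (z - third p s)^-1)).
Proof.
move=> s0; set b := third p s.
have H z v m : re (z - b) ^+ 2 + im (z - b) ^+ 2 <= s ^+ 2 ->
    0 < re (z - b) ^+ 2 + im (z - b) ^+ 2 ->
    m * s ^+ 2 <= re (z - b) * im v - im (z - b) * re v -> 0 <= m ->
    m <= im ((z - b)^-1 * v).
  rewrite imM imV (_ : re (z - b)^-1 = re (z - b) / rnorm (z - b) ^+ 2); last first.
    by rewrite rnorm_sqr; case: (z - b).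
  rewrite rnorm_sqr; set q := _ + _ => qs q0 ms m0.
  have -> : re (z - b) / q * im v + - im (z - b) / q * re v =
     (re (z - b) * im v - im (z - b) * re v) / q by field; rewrite gt_eqF.
  rewrite ler_pdivlMr //; apply: le_trans ms.
  by rewrite ler_wpM2l.
have HE z v x y vx vy m : re (z - b) = x -> im (z - b) = y -> re v = vx -> im v = vy ->
    x ^+ 2 + y ^+ 2 <= s ^+ 2 -> 0 < x ^+ 2 + y ^+ 2 ->
    m * s ^+ 2 <= x * vy - y * vx -> 0 <= m -> m <= im ((z - b)^-1 * v).
  by move=> <- <- <- <-; exact: H.
have t3 t : 0 <= t <= 1 -> 0 <= t * s <= s.
  by move=> /andP[t0 t1]; rewrite ler_piMl ?(ltW s0) // mulr_ge0 ?(ltW s0).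
have sq_le (x c : R) : 0 <= c <= 1 -> - (c * s) <= x <= c * s -> x ^+ 2 <= c ^+ 2 * s ^+ 2.
  move=> c0 xc; rewrite -exprMn -[leLHS]real_normK ?num_real //.
  by rewrite ler_sqr ?nnegrE ?normr_ge0 ?ler_norml ?mulr_ge0 ?(ltW s0) //; case/andP: c0.
have sum_le (x y : R) : - (2 / 3 * s) <= x <= 2 / 3 * s -> - (2 / 3 * s) <= y <= 2 / 3 * s ->
    x ^+ 2 + y ^+ 2 <= s ^+ 2.
  have c01 : 0 <= (2 / 3 : R) <= 1 by lra.
  move=> hx hy; have h1 := @sq_le x _ c01 hx; have h2 := @sq_le y _ c01 hy.
  by have := exprn_gt0 2 s0; lra.
have sum_gt0 (x y : R) : x != 0 \/ y != 0 -> 0 < x ^+ 2 + y ^+ 2.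
  by case=> h; [rewrite ltr_pwDl|rewrite ltr_wpDl]; rewrite ?sqr_ge0 // exprn_even_gt0.
have s3 : - (1 / 3 * s) != 0 by rewrite oppr_eq0 mulf_neq0 ?gt_eqF.
have s23 : 2 / 3 * s != 0 by rewrite mulf_neq0 ?gt_eqF.
rewrite /loop !imD !imN.
have h1 : 1 / 3 <= im (seg n p (rc s) (fun z => (z - b)^-1)).
  apply: seg_im_ge => t /t3 ht.
  apply: (HE _ _ (t * s - 1 / 3 * s) (- (1 / 3 * s)) s 0) => //.
  - by rewrite /b /third ?reimE; lra.
  - by rewrite /b /third ?reimE; lra.
  - by apply: sum_le; lra.
  - by apply: sum_gt0; right.
  - lra.
have h2 : 2 / 3 <= im (seg n (p + rc s) (ii s) (fun z => (z - b)^-1)).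
  apply: seg_im_ge => t /t3 ht.
  apply: (HE _ _ (2 / 3 * s) (t * s - 1 / 3 * s) 0 s) => //.
  - by rewrite /b /third ?reimE; lra.
  - by rewrite /b /third ?reimE; lra.
  - by apply: sum_le; lra.
  - by apply: sum_gt0; left.
  - lra.
have h4 : im (seg n p (ii s) (fun z => (z - b)^-1)) <= - (1 / 3).
  rewrite -[leLHS]opprK lerNl opprK -imN -mulN1r -segZ.
  apply: seg_im_ge => t /t3 ht; rewrite mulN1r mulNr -mulrN.
  apply: (HE _ _ (- (1 / 3 * s)) (t * s - 1 / 3 * s) 0 (- s)) => //.
  - by rewrite /b /third ?reimE; lra.
  - by rewrite /b /third ?reimE; lra.
  - by rewrite reN re_ii oppr0.
  - by apply: sum_le; lra.
  - by apply: sum_gt0; left.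
  - lra.
have h3 : im (seg n (p + ii s) (rc s) (fun z => (z - b)^-1)) <= - (2 / 3).
  rewrite -[leLHS]opprK lerNl opprK -imN -mulN1r -segZ.
  apply: seg_im_ge => t /t3 ht; rewrite mulN1r mulNr -mulrN.
  apply: (HE _ _ (t * s - 1 / 3 * s) (2 / 3 * s) (- s) 0) => //.
  - by rewrite /b /third ?reimE; lra.
  - by rewrite /b /third ?reimE; lra.
  - by rewrite imN im_rc oppr0.
  - by apply: sum_le; lra.
  - by apply: sum_gt0; right.
  - lra.
lra.
Qed.

Lemma rnorm_third p s z : 0 < s -> square_bd p s z -> s / 3 <= rnorm (z - third p s).
Proof.
move=> s0 [zs]; rewrite /square /= in zs.
case/or4P => /eqP e.
- apply: le_trans (re_le_rnorm _); rewrite /third ?reimE e ler_normr; lra.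
- apply: le_trans (re_le_rnorm _); rewrite /third ?reimE e ler_normr; lra.
- apply: le_trans (im_le_rnorm _); rewrite /third ?reimE e ler_normr; lra.
- apply: le_trans (im_le_rnorm _); rewrite /third ?reimE e ler_normr; lra.
Qed.

Lemma third_in_square p s : 0 < s -> square p s (third p s).
Proof. by move=> s0; rewrite /square /third /= ?reimE; lra. Qed.

(* The constant is not sharp: only its independence of [h] matters. *)
Lemma weak_cauchy p s h (M : R) : 0 < s ->
  (forall z, square p s z -> derivable h z 1) ->
  (forall z, square_bd p s z -> rnorm (h z) <= M) ->
  rnorm (h (third p s)) <= 6 * M.
Proof.
move=> s0 hd hM; set b := third p s.
(* As [0^-1 = 0], [phi b] is 0 and not [l]; what [goursat_third] asks of [phi] near [b] is a bound,
   here [B]. *)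
pose phi z : C := (h z - h b) * (z - b)^-1.
have [l hl] := (cderivableP _ _).1 (hd _ (third_in_square p s0)).
have [d d0 hb] := hl 1 ltr01; rewrite -/b in hb.
pose B := rnorm l + 1.
have B0 : 0 < B by rewrite /B; have := rnorm_ge0 l; lra.
have phiB z : rnorm (z - b) < d -> rnorm (phi z) <= B.
  move=> zd; have [->|zb] := eqVneq z b.
    by rewrite /phi subrr mul0r rnorm0 ltW.
  have nz : 0 < rnorm (z - b) by rewrite rnorm_gt0 subr_eq0.
  rewrite /phi rnormM rnormV ler_pdivrMr //.
  have -> : h z - h b = (h z - h b - l * (z - b)) + l * (z - b) by ring.
  apply: (le_trans (rnormD _ _)); rewrite rnormM.
  by have := hb _ zd; rewrite /B; lra.
have phid z : square p s z -> z <> b -> derivable phi z 1.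
  move=> zs /eqP zb; apply: cderivableM; last exact: cderivable_subV.
  by apply: cderivableB; exact: hd.
have small (eta : R) : 0 < eta -> exists n, rnorm (loop n p s phi) <= eta.
  move=> eta0.
  (* The first bound puts the last square where [phi] is bounded by [B], the second makes its share
     [4 * (s / 4 ^+ k) * B] at most [eta / 2]. *)
  have [k kd] : exists k, s * (4^-1) ^+ k < Num.min (d / 2) (eta / (8 * B)).
    apply: expr_small; first by rewrite ger0_norm ?invr_ge0 // invf_lt1 // ltr1n.
    by rewrite lt_min !divr_gt0 // mulr_gt0.
  rewrite lt_min exprVn in kd; move/andP: kd => [kd ke].
  have kd2 : 2 * (s / 4 ^+ k) < d by lra.
  have [|N hN] := goursat_third s0 (ltW B0) phid phiB kd2 (eta := eta / 2).
    by rewrite divr_gt0.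
  exists N; apply: (le_trans (hN N (leqnn _))).
  by rewrite ltr_pdivlMr ?mulr_gt0 // in ke; lra.
apply/ler_addgt0Pr => eta eta0.
have [n hn] := small eta eta0.
have e : (fun z => h z * (z - b)^-1) = (fun z => phi z + h b * (z - b)^-1).
  by apply/funext => z; rewrite /phi; ring.
(* Origin of the 6: [|z - b|] is at least [s / 3] on the boundary, so this sum is at most [12 * M],
   while up to [eta] it is at least [2 * rnorm (h b)] by [im_loop_third]. *)
have h1 : rnorm (loop n p s (fun z => h z * (z - b)^-1)) <= 4 * s * (M * (3 / s)).
  apply: loop_le; first exact: ltW.
  move=> z zb; rewrite rnormM rnormV.
  have zt := rnorm_third s0 zb; have s3 : 0 < s / 3 by lra.
  apply: ler_pM; rewrite ?rnorm_ge0 ?invr_ge0 ?rnorm_ge0 //; first exact: hM.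
  by rewrite -[leRHS]invrK lef_pV2 ?posrE ?invf_div //; exact: lt_le_trans zt.
have e12 : 4 * s * (M * (3 / s)) = 12 * M by field; rewrite gt_eqF.
have h2 := le_trans (ler_norm _) (im_le_rnorm (loop n p s (fun z => (z - b)^-1))).
have h3 := im_loop_third n p s0; rewrite -/b in h3.
have h4 : 2 * rnorm (h b) <= rnorm (h b) * rnorm (loop n p s (fun z => (z - b)^-1)).
  by rewrite mulrC ler_wpM2l ?rnorm_ge0 //; lra.
rewrite -rnormM -loopZ in h4.
have h5 : loop n p s (fun z => h b * (z - b)^-1) =
   loop n p s (fun z => h z * (z - b)^-1) - loop n p s phi.
  by rewrite e loopD; ring.
rewrite h5 in h4.
have := rnormD (loop n p s (fun z => h z * (z - b)^-1)) (- loop n p s phi).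
rewrite rnormN; lra.
Qed.

End MaximumPrinciple.

(** * Identity principle and open mapping *)

Section OpenMapping.
Variable R : realType.
Local Notation C := (cplx R).
Implicit Types (p z w v : C) (s t : R) (f g : C -> C).

(** With [0^-1 = 0] the function takes the value 0 at [b], and its difference quotient there is
    exactly the square of that of [f]. *)
Lemma cderivable_sqr_div f b : derivable f b 1 -> f b = 0 ->
  derivable (fun z => f z ^+ 2 * (z - b)^-1 : C) b 1.
Proof.
move=> /cvg_ex[/= l hl] fb; apply/cvg_ex; exists (l * l).
have := cvgM hl hl; rewrite /mul_fun => {}hl.
rewrite [X in X @ _ --> _](_ : _ = fun h : C =>
  h^-1 *: (f (h *: 1 + b) - f b) * (h^-1 *: (f (h *: 1 + b) - f b))); first exact: hl.
apply/funext => h; rewrite /GRing.scale /= fb subr0 subrr invr0 mulr0 subr0 addrK.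
by rewrite !mulr1; set A := f _; ring.
Qed.

Lemma cderivable_prod_subV (l : seq C) z : z \notin l ->
  derivable (fun w => \prod_(b <- l) (w - b)^-1 : C) z 1.
Proof.
elim: l => [|b l IH].
  move=> _; have -> : (fun w : C => \prod_(b <- [::]) (w - b)^-1) = cst 1.
    by apply/funext => w; rewrite big_nil.
  exact: derivable_cst.
rewrite inE negb_or => /andP[zb zl].
have -> : (fun w : C => \prod_(c <- b :: l) (w - c)^-1) =
   (fun w => (w - b)^-1 * \prod_(c <- l) (w - c)^-1).
  by apply/funext => w; rewrite big_cons.
by apply: cderivableM; [exact: cderivable_subV | exact: IH].
Qed.

(** Since [l] has no repetition, at most one factor is singular at [z], and [cderivable_sqr_div]
    absorbs it. *)
Lemma cderivable_div_zeros (l : seq C) f z : uniq l ->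
  (forall b, b \in l -> f b = 0) -> derivable f z 1 ->
  derivable (fun w => f w ^+ 2 * \prod_(b <- l) (w - b)^-1 : C) z 1.
Proof.
move=> + + fd; elim: l => [|b l IH].
  move=> _ _; have -> : (fun w => f w ^+ 2 * \prod_(b <- [::]) (w - b)^-1) =
    (fun w => f w * f w).
    by apply/funext => w; rewrite big_nil mulr1.
  exact: cderivableM.
move=> /= /andP[bl ul] h.
have [zb|zb] := eqVneq z b.
  have -> : (fun w => f w ^+ 2 * \prod_(c <- b :: l) (w - c)^-1) =
    (fun w => f w ^+ 2 * (w - b)^-1 * \prod_(c <- l) (w - c)^-1).
    by apply/funext => w; rewrite big_cons mulrA.
  apply: cderivableM; last by apply: cderivable_prod_subV; rewrite zb.
  by rewrite zb in fd *; apply: cderivable_sqr_div => //; apply: h; rewrite mem_head.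
have -> : (fun w => f w ^+ 2 * \prod_(c <- b :: l) (w - c)^-1) =
  (fun w => (w - b)^-1 * (f w ^+ 2 * \prod_(c <- l) (w - c)^-1)).
  by apply/funext => w; rewrite big_cons mulrCA.
apply: cderivableM; first exact: cderivable_subV.
by apply: IH => // c cl; apply: h; rewrite inE cl orbT.
Qed.

Lemma rnorm_prod_le (l : seq C) (F : C -> C) (c : R) :
  (forall b, b \in l -> rnorm (F b) <= c) ->
  rnorm (\prod_(b <- l) F b) <= c ^+ size l.
Proof.
elim: l => [|b l IH] h; first by rewrite big_nil rnorm1.
rewrite big_cons rnormM exprS ler_pM ?rnorm_ge0 //; first exact/h/mem_head.
by apply: IH => d dl; apply: h; rewrite inE dl orbT.
Qed.

Lemma rnorm_prod_ge (l : seq C) (F : C -> C) (c : R) : 0 <= c ->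
  (forall b, b \in l -> c <= rnorm (F b)) ->
  c ^+ size l <= rnorm (\prod_(b <- l) F b).
Proof.
move=> c0; elim: l => [|b l IH] h; first by rewrite big_nil rnorm1.
rewrite big_cons rnormM exprS ler_pM ?exprn_ge0 //; first exact/h/mem_head.
by apply: IH => d dl; apply: h; rewrite inE dl orbT.
Qed.

Lemma le_div_inv (x s c : R) : 0 < s -> 0 < c -> 0 < x -> x <= s / c -> c / s <= x^-1.
Proof. by move=> s0 c0 x0 h; rewrite -(invf_div s c) lef_pV2 // posrE divr_gt0. Qed.

Lemma le_inv_div (x s c : R) : 0 < s -> 0 < c -> s / c <= x -> x^-1 <= c / s.
Proof.
move=> s0 c0 h; have sc : 0 < s / c by rewrite divr_gt0.
by rewrite -(invf_div s c) lef_pV2 // posrE //; exact: lt_le_trans h.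
Qed.

Lemma third_sub z s : third (z - rc (s / 3) - ii (s / 3)) s = z.
Proof. by rewrite /third; ring. Qed.

(* The Cauchy estimate for [f ^ 2 / \prod_b (z - b)], over [N] zeros [b] of [f]
   close to [a], gives [f z ^ 2 = O((3 / 4) ^ N)]. The square makes the quotient
   differentiable at the zeros without a removable singularity theorem. *)
Lemma identity_principle f a r : 0 < r ->
  (forall z, rnorm (z - a) < r -> derivable f z 1) ->
  (forall e : R, 0 < e -> exists b, [/\ b != a, rnorm (b - a) < e & f b = 0]) ->
  exists2 d : R, 0 < d & forall z, rnorm (z - a) < d -> f z = 0.
Proof.
move=> r0 fd fz.
have [M M0 [r1 r10 hM]] : exists2 M, 0 <= M & exists2 r1 : R, 0 < r1 &
    forall z, rnorm (z - a) < r1 -> rnorm (f z) <= M.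
  exists (rnorm (f a) + 1); first by rewrite addr_ge0 ?rnorm_ge0.
  have : derivable f a 1 by apply: fd; rewrite subrr rnorm0.
  move=> /cderivable_continuous/(ccvgP _)/(_ _ ltr01)/cnbhsP[r1 r10 h].
  exists r1 => // z /h /=; have := rnormBl (f z) (f a); lra.
pose s := Num.min r r1 / 4.
have s0 : 0 < s by rewrite divr_gt0 // lt_min r0.
have sr : 4 * s <= r.
  by have : Num.min r r1 <= r by [rewrite ge_min lexx]; rewrite /s; lra.
have sr1 : 4 * s <= r1.
  by have : Num.min r r1 <= r1 by [rewrite ge_min lexx orbT]; rewrite /s; lra.
(* The lower bound [e] on the distances to [a] ensures that the next zero, chosen closer to [a] than
   [e], is new. *)
have zeros N : exists (l : seq C) (e : R), [/\ 0 < e, uniq l, size l = N &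
    forall b, b \in l -> [/\ e <= rnorm (b - a), rnorm (b - a) < s / 24 & f b = 0]].
  elim: N => [|N [l [e [e0 ul sl hl]]]]; first by exists [::], 1.
  have [|b [ba be fb]] := fz (Num.min e (s / 24)).
    by rewrite lt_min e0 divr_gt0.
  move: be; rewrite lt_min => /andP[be bs].
  exists (b :: l), (rnorm (b - a)); split.
  - by rewrite rnorm_gt0 subr_eq0.
  - rewrite /= ul andbT; apply/negP => /hl[+ _ _]; lra.
  - by rewrite /= sl.
  - move=> c; rewrite inE => /predU1P[->//|/hl[h1 h2 h3]]; split => //; lra.
exists (s / 12); first by rewrite divr_gt0.
move=> z za; apply/eqP/negPn/negP => fz0.
have fz2 : 0 < rnorm (f z) ^+ 2 by rewrite exprn_gt0 // rnorm_gt0.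
(* The ratio is [(6 / s) / (8 / s)]: zeros within [s / 24] of [a] are within [s / 8] of [z], but at
   least [s / 3 - s / 8 >= s / 6] away from the boundary of the square around [z]. *)
have [N hN] : exists N, 6 * M ^+ 2 * (3 / 4) ^+ N < rnorm (f z) ^+ 2.
  by apply: expr_small => //; rewrite ger0_norm; lra.
have [l [e [e0 ul sl hl]]] := zeros N.
have Qa w : square (z - rc (s / 3) - ii (s / 3)) s w -> rnorm (w - a) < 4 * s.
  move=> ws; have := rnorm_triangle z w a.
  have := square_rnorm ws (third_in_square _ s0); rewrite third_sub; lra.
have := @weak_cauchy R (z - rc (s / 3) - ii (s / 3)) s
  (fun w => f w ^+ 2 * \prod_(b <- l) (w - b)^-1) (M ^+ 2 * (6 / s) ^+ N) s0.
rewrite third_sub => H.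
suff : rnorm (f z) ^+ 2 * (8 / s) ^+ N <= 6 * (M ^+ 2 * (6 / s) ^+ N).
  have -> : (6 / s) ^+ N = (3 / 4) ^+ N * (8 / s) ^+ N.
    by rewrite -exprMn; congr (_ ^+ _); field; rewrite gt_eqF.
  have s8 : 0 < (8 / s) ^+ N by rewrite exprn_gt0 // divr_gt0.
  by rewrite !mulrA (ler_pM2r s8) => ?; lra.
apply: le_trans (H _ _).
- rewrite rnormM rnormX ler_wpM2l ?exprn_ge0 ?rnorm_ge0 // -sl.
  apply: rnorm_prod_ge => [|b /hl[_ bs fb]]; first by rewrite divr_ge0 // ltW.
  have zb : 0 < rnorm (z - b).
    by rewrite rnorm_gt0 subr_eq0; apply: contraNneq fz0 => ->; rewrite fb.
  rewrite rnormV; apply: le_div_inv => //.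
  by have := rnorm_triangle a z b; rewrite (rnormB a b); lra.
- move=> w /Qa wa; apply: cderivable_div_zeros => // [b /hl[]//|].
  by apply: fd; lra.
- move=> w wb; have wa := Qa _ wb.1.
  rewrite rnormM rnormX ler_pM ?exprn_ge0 ?rnorm_ge0 //.
    by rewrite lerXn2r ?nnegrE ?rnorm_ge0 //; apply: hM; lra.
  rewrite -sl; apply: rnorm_prod_le => b /hl[_ bs fb].
  have := rnorm_third s0 wb; rewrite third_sub => wz.
  have wbs : s / 6 <= rnorm (w - b).
    have := rnorm_triangle b w z; have := rnorm_triangle a b z.
    by rewrite (rnormB a z); lra.
  by rewrite rnormV; exact: le_inv_div.
Qed.

(* If [w] is not taken, the Cauchy estimate applies to [1 / (f - w)]. *)
Lemma open_mapping f a r : 0 < r ->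
  (forall z, rnorm (z - a) < r -> derivable f z 1) ->
  ~ (exists2 d : R, 0 < d & forall z, rnorm (z - a) < d -> f z = f a) ->
  forall e : R, 0 < e -> exists2 d : R, 0 < d & forall w, rnorm (w - f a) < d ->
    exists2 z, rnorm (z - a) < e & f z = w.
Proof.
move=> r0 fd nc e e0.
(* Otherwise the zeros of [f - f a] would accumulate at [a], and [f] would be constant near [a]. *)
have [e1 e10 he1] : exists2 e1 : R, 0 < e1 &
    forall z, rnorm (z - a) < e1 -> z != a -> f z != f a.
  apply: contrapT => hn; apply: nc.
  have [||d d0 hd] := @identity_principle (fun z => f z - f a) a r r0.
  - by move=> z /fd; exact: cderivableB.
  - move=> c c0; apply: contrapT => hc; apply: hn; exists c => // z zc za.
    by apply/eqP => fza; apply: hc; exists z; split => //; rewrite fza subrr.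
  - by exists d => // z /hd/eqP; rewrite subr_eq0 => /eqP.
pose s := Num.min e (Num.min r e1) / 4.
have [s0 se sr se1] : [/\ 0 < s, 4 * s <= e, 4 * s <= r & 4 * s <= e1].
  have h1 : Num.min e (Num.min r e1) <= e by rewrite ge_min lexx.
  have h2 : Num.min e (Num.min r e1) <= r by rewrite !ge_min lexx orbT.
  have h3 : Num.min e (Num.min r e1) <= e1 by rewrite !ge_min lexx !orbT.
  have h0 : 0 < Num.min e (Num.min r e1) by rewrite !lt_min e0 r0.
  by rewrite /s; split; lra.
set p := a - rc (s / 3) - ii (s / 3).
have Qa w : square p s w -> rnorm (w - a) < 4 * s.
  move=> ws; have := square_rnorm ws (third_in_square p s0).
  by rewrite third_sub; lra.
(* By [square_induction]: small squares near [a] contain no boundary point, and near any other point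
   the bound comes from continuity. *)
have [m m0 hm] : exists2 m : R, 0 < m &
    forall z, square_bd p s z -> m <= rnorm (f z - f a).
  suff [m m0 hm] : exists2 m : R, 0 < m &
      forall z, square p s z -> square_bd p s z -> m <= rnorm (f z - f a).
    by exists m => // z zb; apply: hm => //; exact: zb.1.
  apply: (square_induction (P := fun q t => exists2 m : R, 0 < m &
      forall z, square q t z -> square_bd p s z -> m <= rnorm (f z - f a))) => //.
  - move=> q t t0 hq.
    have [m1 m10 h1] := hq _ (Or41 _ _ _ (erefl _)).
    have [m2 m20 h2] := hq _ (Or42 _ _ _ (erefl _)).
    have [m3 m30 h3] := hq _ (Or43 _ _ _ (erefl _)).
    have [m4 m40 h4] := hq _ (Or44 _ _ _ (erefl _)).
    exists (Num.min (Num.min m1 m2) (Num.min m3 m4)); first by rewrite !lt_min m10 m20 m30.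
    move=> z zq zb; rewrite !ge_min.
    have [zr|zr] := leP (re z) (re q + t / 2); have [zi|zi] := leP (im z) (im q + t / 2).
    + by rewrite h1 //; move: zq; rewrite /square /= ?reimE; lra.
    + by rewrite h3 ?orbT //; move: zq; rewrite /square /= ?reimE; lra.
    + by rewrite h2 ?orbT //; move: zq; rewrite /square /= ?reimE; lra.
    + by rewrite h4 ?orbT //; move: zq; rewrite /square /= ?reimE; lra.
  - move=> z zs; have [->|za] := eqVneq z a.
      (* A square of side below [s / 7] through [a] stays within [2 * s / 7 < s / 3] of [a] and
         misses the boundary, so any bound will do. *)
      exists (s / 7); first by rewrite divr_gt0.
      move=> q t /andP[t0 ts] aq _; exists 1 => // w wq wb.
      have := rnorm_third s0 wb; rewrite third_sub.
      have := square_rnorm wq aq; lra.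
    have c0 : 0 < rnorm (f z - f a).
      by rewrite rnorm_gt0 subr_eq0 he1 //; have := Qa _ zs; lra.
    have : derivable f z 1 by apply: fd; have := Qa _ zs; lra.
    move=> /cderivable_continuous/(ccvgP _)/(_ _ (divr_gt0 c0 (ltr0Sn _ 1))).
    move=> /cnbhsP[d d0 hd]; exists (d / 2); first by rewrite divr_gt0.
    move=> q t /andP[t0 td] zq _; exists (rnorm (f z - f a) / 2); first by rewrite divr_gt0.
    move=> w wq _; have /hd /= : rnorm (w - z) < d.
      by have := square_rnorm wq zq; lra.
    have := rnorm_triangle (f w) (f z) (f a); rewrite (rnormB (f z) (f w)); lra.
(* On the boundary [|f - w|] is at least [7 * m / 8]; an omitted [w] would satisfy
   [|w - f a| >= 7 * m / 48], which exceeds [m / 8]. *)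
exists (m / 8); first by rewrite divr_gt0.
move=> w wa; apply: contrapT => hn.
have fw z : square p s z -> f z - w != 0.
  move=> /Qa zs; rewrite subr_eq0; apply/eqP => fzw; apply: hn; exists z => //; lra.
have := @weak_cauchy R p s (fun z => (f z - w)^-1) (7 * m / 8)^-1 s0.
have m78 : 0 < 7 * m / 8 by rewrite divr_gt0 // mulr_gt0.
rewrite third_sub rnormV (rnormB (f a)) => H.
have {}H : (rnorm (w - f a))^-1 <= 6 * (7 * m / 8)^-1.
  apply: H.
  - move=> z zs; apply: cderivableV; last exact: fw.
    by apply/cderivableB/fd; have := Qa _ zs; lra.
  - move=> z zb; have h0 : 0 < rnorm (f z - w) by rewrite rnorm_gt0 fw //; exact: zb.1.
    rewrite rnormV lef_pV2 ?posrE //.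
    have := hm _ zb; have := rnorm_triangle w (f z) (f a); lra.
have wa0 : 0 < rnorm (w - f a).
  rewrite rnormB rnorm_gt0; apply: fw.
  by rewrite -[X in square _ _ X](third_sub a s); exact: third_in_square.
have : 1 <= 6 * (7 * m / 8)^-1 * rnorm (w - f a).
  by rewrite -ler_pdivrMr // div1r.
rewrite mulrAC ler_pdivlMr //; lra.
Qed.

End OpenMapping.

(** * Topology of the plane and the sphere *)

Section Topology.
Variable R : realType.
Local Notation C := (cplx R).
Local Notation Chat := (sphere R).

Lemma closedD (T : topologicalType) (A B : set T) :
  closed A -> open B -> closed (A `\` B).
Proof. by move=> cA oB; apply: closedI => //; exact: open_closedC. Qed.

Lemma quasi_component (T : topologicalType) (Y : set T) (x y : T) :
  hausdorff_space T -> compact [set: T] -> closed Y -> Y x ->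
  ~ connected_component Y x y ->
  exists Q : set T, [/\ closed Q, closed (Y `\` Q), Q `<=` Y, Q x & ~ Q y].
Proof.
move=> hT cT cY Yx nxy.
pose QQ := [set Q : set T | [/\ closed Q, closed (Y `\` Q), Q `<=` Y & Q x]].
apply: contrapT => hn; apply: nxy.
pose K := \bigcap_(Q in QQ) Q.
have QQY : QQ Y by split => //; rewrite setDv; exact: closed0.
have QQI P Q : QQ P -> QQ Q -> QQ (P `&` Q).
  move=> [P1 P2 P3 P4] [Q1 Q2 Q3 Q4]; split => //.
  - exact: closedI.
  - by rewrite setDIr; exact: closedU.
  - by move=> z [/P3].
have Kx : K x by move=> Q [].
have Ky : K y.
  by move=> Q [Q1 Q2 Q3 Q4]; apply: contrapT => nQy; apply: hn; exists Q.
have clK : closed K by apply: closed_bigI => Q [].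
have KY : K `<=` Y by move=> z /(_ Y QQY).
(* By compactness the piece [A1] is cut out of [K] by a clopen piece of [Y]. *)
have key A1 A2 : closed A1 -> closed A2 -> A1 `&` A2 = set0 -> A1 `|` A2 = K ->
    A1 x -> A2 = set0.
  move=> c1 c2 d12 u12 A1x.
  have [V1 [V2 [oO1 oO2 A1O1 A2O2 O12]]] : exists V1 V2 : set T,
      [/\ open V1, open V2, A1 `<=` V1, A2 `<=` V2 & V1 `&` V2 = set0].
    have /(compact_normal hT cT c1) : set_nbhs A1 (~` A2).
      apply/set_nbhsP; exists (~` A2); split => //; first exact: closed_openC.
      by move=> z A1z A2z; have : (A1 `&` A2) z by []; rewrite d12.
    move=> [B /set_nbhsP[V1 [oO1 A1O1 O1B]] BA2].
    exists V1, (~` closure B); split => //.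
    - exact/closed_openC/closed_closure.
    - by move=> z A2z /BA2.
    - by apply/seteqP; split => // z [/O1B/subset_closure].
  (* Otherwise the nonempty closed sets obtained by removing [V1] and [V2] from the pieces form a
     filter base; its cluster point lies in every piece, hence in [K], yet outside [V1] and [V2]. *)
  have [Q QQ1 QO] : exists2 Q, QQ Q & Q `<=` V1 `|` V2.
    apply: contrapT => /forall2NP nQ.
    pose F := filter_from QQ (fun Q => Q `\` (V1 `|` V2)).
    have FF : ProperFilter F.
      apply: filter_from_proper.
        apply: filter_from_filter; first by exists Y.
        move=> P Q QP QQ1; exists (P `&` Q); first exact: QQI.
        by move=> z [[]].
      move=> Q QQ1; apply: contrapT => /forallNP nz; case: (nQ Q) => //; apply.
      by move=> z Qz; apply: contrapT => nO; apply: (nz z).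
    have [|p [_ clp]] := cT F FF; first exact: filterT.
    have pn Q : QQ Q -> (Q `\` (V1 `|` V2)) p.
      move=> QQ1; have clQ : closed (Q `\` (V1 `|` V2)).
        by apply: closedD; [case: QQ1|exact: openU].
      by apply: clQ; rewrite clusterE in clp; apply: clp; exists Q.
    have Kp : K p by move=> Q /pn[].
    have [_ nO] := pn Y QQY; apply: nO.
    by move: Kp; rewrite -u12 => -[/A1O1|/A2O2]; [left|right].
  have QQO1 : QQ (Q `&` V1).
    have e1 : Q `&` V1 = Q `\` V2.
      apply/seteqP; split => z [Qz]; last by move=> nO2; split => //; case: (QO z Qz).
      by move=> O1z; split => // O2z; have : (V1 `&` V2) z by []; rewrite O12.
    case: QQ1 => Q1 Q2 Q3 Q4; split.
    - by rewrite e1; exact: closedD.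
    - by rewrite setDIr; apply: closedU => //; exact: closedD.
    - by move=> z [/Q3].
    - by split => //; exact: A1O1.
  apply/seteqP; split => // z A2z.
  have [_ O1z] : (Q `&` V1) z by have : K z by [rewrite -u12; right]; apply.
  by have : (V1 `&` V2) z by [split => //; exact: A2O2]; rewrite O12.
(* For [B] clopen in [K], [key] is applied with [A1] whichever of [B] and its complement in [K]
   contains [x]. *)
exists K => //; split => // B [b Bb] [W oW BW] [D cD BD].
have cB : closed B by rewrite BD; exact: closedI.
have cKB : closed (K `\` B).
  rewrite (_ : K `\` B = K `&` ~` W); first by apply: closedI => //; exact: open_closedC.
  rewrite BW; apply/seteqP; split => z [Kz h]; split => //; first by move=> Wz; apply: h.
  by move=> [_ /h].
have BK : B `<=` K by rewrite BW => z [].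
have [Bx|nBx] := pselect (B x).
  have := key B (K `\` B) cB cKB; rewrite setDIK setDUK // => /(_ erefl erefl Bx) e.
  by apply/seteqP; split => // z Kz; apply: contrapT => nBz;
    have : (K `\` B) z by []; rewrite e.
have := key (K `\` B) B cKB cB; rewrite setIC setDIK setUC setDUK //.
by move=> /(_ erefl erefl (conj Kx nBx)) B0; rewrite B0 in Bb.
Qed.

End Topology.

(** * The topology of the sphere; meromorphic functions as continuous and open maps *)

Section Meromorphic.
Variable R : realType.
Local Notation C := (cplx R).
Local Notation Chat := (sphere R).

Lemma rc_continuous_line (a v : C) : continuous (fun t : R => a + rc t * v).
Proof.
move=> t; apply/(ccvgP _) => e e0.
have v1 : 0 < rnorm v + 1 by have := rnorm_ge0 v; lra.
apply/nbhs_ballP; exists (e / (rnorm v + 1)); first by rewrite /= divr_gt0.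
move=> u /=; rewrite distrC => tu.
have -> : a + rc u * v - (a + rc t * v) = rc (u - t) * v.
  by rewrite rcD rcN; ring.
rewrite rnormM rnorm_rc; rewrite ltr_pdivlMr // in tu.
by apply: le_lt_trans tu; rewrite ler_wpM2l ?normr_ge0 //; lra.
Qed.

Lemma segment_path_connected (a v : C) :
  connected ((fun t : R => a + rc t * v) @` `[0, 1]).
Proof.
apply: connected_continuous_connected; first exact: segment_connected.
by apply: continuous_subspaceT; exact: rc_continuous_line.
Qed.

Lemma star_connected (A : set C) a : A a ->
  (forall z t, A z -> 0 <= t <= 1 -> A (a + rc t * (z - a))) -> connected A.
Proof.
move=> Aa h.
have -> : A = \bigcup_(z in A) ((fun t : R => a + rc t * (z - a)) @` `[0, 1]).
  apply/seteqP; split => z.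
    move=> Az; exists z => //; exists 1; last by rewrite rc1; ring.
    by rewrite /= in_itv /= ler01 lexx.
  by move=> [w Aw [t /=]]; rewrite in_itv /= => t01 <-; exact: h.
apply: bigcup_connected; last by move=> z _; exact: segment_path_connected.
exists a => z _; exists 0; last by rewrite rc0; ring.
by rewrite /= in_itv /= ler01 lexx.
Qed.

Lemma ball_connected (a : C) (r : R) : connected [set z : C | rnorm (z - a) < r].
Proof.
have [r0|r0] := ltP 0 r; last first.
  have -> : [set z : C | rnorm (z - a) < r] = set0; last exact: connected0.
  by apply/seteqP; split => // z /=; have := rnorm_ge0 (z - a); lra.
apply: (@star_connected _ a) => /=; first by rewrite subrr rnorm0.
move=> z t zr /andP[t0 t1].
have -> : a + rc t * (z - a) - a = rc t * (z - a) by ring.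
rewrite rnormM rnorm_rc ger0_norm //; apply: le_lt_trans zr.
by rewrite ler_piMl // rnorm_ge0.
Qed.

Lemma mkc_continuous : continuous (fun p : R * R => mkc p.1 p.2 : C).
Proof.
move=> [x y]; apply/(ccvgP _) => e e0.
have e2 : 0 < e / 2 by rewrite divr_gt0.
exists ([set u : R | `|x - u| < e / 2], [set v : R | `|y - v| < e / 2]).
  by split; apply/nbhs_ballP; exists (e / 2).
move=> [x' y'] [/= h1 h2].
change (is_true (rnorm (mkc x' y' - mkc x y) < e)); rewrite mkcN mkcD; apply: (le_lt_trans (rnorm_le _)) => /=.
by rewrite -[X in _ < X](@half2 R) // ; rewrite (distrC x' x) (distrC y' y); lra.
Qed.

Lemma square_compact (p : C) (s : R) : compact (square p s).
Proof.
have -> : square p s = (fun p : R * R => mkc p.1 p.2 : C) @`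
   (`[re p, re p + s] `*` `[im p, im p + s]).
  apply/seteqP; split => z.
    move=> /andP[h1 h2]; exists (re z, im z); last exact: mkc_eta.
    by split; rewrite /= in_itv.
  move=> [[x y] [/=]]; rewrite !in_itv /= => h1 h2 <-.
  by apply/andP; split.
apply: continuous_compact; first exact/continuous_subspaceT/mkc_continuous.
by apply: compact_setX; exact: segment_compact.
Qed.

Lemma cplx_hausdorff : hausdorff_space C.
Proof. exact: norm_hausdorff. Qed.

Lemma square_nbhs (a : C) (s : R) : 0 < s ->
  forall z, rnorm (z - a) < s -> square (a - rc s - ii s) (2 * s) z.
Proof.
move=> s0 z zs; have := re_le_rnorm (z - a); have := im_le_rnorm (z - a).
rewrite !ler_norml /square /= ?reimE; lra.
Qed.

Lemma cplx_locally_compact : locally_compact [set: C].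
Proof.
move=> z _; rewrite withinET; exists (square (z - rc 1 - ii 1) (2 * 1)).
  by apply/cnbhsP; exists 1 => //; apply: square_nbhs.
split; first exact: square_compact.
by apply: compact_closed; [exact: cplx_hausdorff|exact: square_compact].
Qed.

Lemma sphere_hausdorff : hausdorff_space Chat.
Proof.
apply: one_point_compactification_hausdorff; [exact: cplx_locally_compact|].
exact: cplx_hausdorff.
Qed.

Lemma sphere_compact : compact [set: Chat].
Proof. exact: one_point_compactification_compact. Qed.

Lemma fin_continuous : continuous (@fin R).
Proof. exact: one_point_compactification_some_continuous. Qed.

Lemma nbhs_infty_compact (K : set C) : compact K -> nbhs (infty R) (~` (@fin R @` K)).
Proof.
move=> cK; exists K.
  by split => //; apply: compact_closed => //; exact: cplx_hausdorff.
by move=> z [[w nK <-] [v Kv [vw]]|-> [v _ //]]; apply: nK; rewrite -vw.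
Qed.

Lemma nbhs_infty_norm (M : R) :
  nbhs (infty R) [set z : Chat | if z is Some w then M < rnorm w else True].
Proof.
have cK : compact (square (0 - rc (`|M| + 1) - ii (`|M| + 1)) (2 * (`|M| + 1))).
  exact: square_compact.
have := nbhs_infty_compact cK; apply: filterS => -[w|//] nw.
rewrite /= ltNge; apply/negP => wM; apply: nw; exists w => //.
apply: square_nbhs; first by have := normr_ge0 M; lra.
by rewrite subr0; have := ler_norm M; lra.
Qed.

Definition finpart (f : C -> Chat) : C -> C := odflt 0 \o f.

Lemma finpartE (f : C -> Chat) z : f z <> infty R -> f z = fin (finpart f z).
Proof. by rewrite /finpart /=; case: (f z). Qed.

Lemma mero_finite (f : C -> Chat) a : meromorphic f -> f a <> infty R ->
  exists2 r : R, 0 < r & forall z, rnorm (z - a) < r -> finite_diff_at f z.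
Proof. by move=> /(_ a)[/cnbhsP//|[]]. Qed.

Lemma mero_continuous (f : C -> Chat) : meromorphic f -> continuous f.
Proof.
move=> mf a; case: (mf a) => [/cnbhsP[r r0 h]|[fa _ fl]].
  have [fa da] : finite_diff_at f a by apply: h; rewrite subrr rnorm0.
  move=> V; rewrite (finpartE fa) => hV.
  have h1 : nbhs a [set z | V (fin (finpart f z))] := cderivable_continuous da hV.
  have h2 : nbhs a [set z | finite_diff_at f z] by apply/cnbhsP; exists r.
  suff : nbhs a (f @^-1` V) by [].
  by apply: filterS2 h1 h2 => z /= Vz [fz _]; rewrite finpartE.
move=> V; rewrite fa => hV; have /cdnbhsP[e e0 h] := fl V hV.
apply/cnbhsP; exists e => // z za; have [->|zna] := eqVneq z a; last exact: h.
by rewrite /= fa; exact: nbhs_singleton.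
Qed.

(** The points near which [f] equals [f a] form an open set. It is closed too: a limit point is no
    pole, by continuity, and there the identity principle applies. It would thus be the whole plane,
    and a constant [f] is rational. *)
Lemma mero_nonconstant (f : C -> Chat) a : meromorphic f -> ~ Defs.rational f ->
  f a <> infty R ->
  ~ (exists2 d : R, 0 < d & forall z, rnorm (z - a) < d -> f z = f a).
Proof.
move=> mf nr fa [d0 d00 hd0]; apply: nr.
pose c := finpart f a.
pose E := [set z | exists2 d : R, 0 < d & forall w, rnorm (w - z) < d -> f w = fin c].
suff ET : E = setT.
  exists c%:P, 1; split; [exact: oner_neq0 | exact: coprimep1 |].
  move=> z; rewrite !hornerE oner_eq0 divr1.
  by have : E z by [rewrite ET]; move=> [d d1]; apply; rewrite subrr rnorm0.
have cT : connected [set: C] by exact: (@star_connected _ 0).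
apply: cT.
- by exists a, d0 => // z /hd0 ->; exact: finpartE.
- exists E; last by rewrite setTI.
  rewrite openE => z [d d1 h]; apply/cnbhsP; exists (d / 2); first by rewrite divr_gt0.
  move=> w wz; exists (d / 2); first by rewrite divr_gt0.
  by move=> v vw; apply: h; have := rnorm_triangle w v z; lra.
- exists E; last by rewrite setTI.
  move=> z clz; apply: contrapT => nEz.
  have near_E (e : R) : 0 < e -> exists2 w, E w & rnorm (w - z) < e.
    move=> e0; have [|w [Ew wz]] := clz [set w | rnorm (w - z) < e].
      by apply/cnbhsP; exists e.
    by exists w.
  have fE w : E w -> f w = fin c.
    by move=> [d d1]; apply; rewrite subrr rnorm0.
  have [fz|fz] := pselect (f z = infty R).
    have : nbhs (f z) (~` (@fin R @` [set c])).
      by rewrite fz; apply: nbhs_infty_compact; exact: compact_set1.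
    move=> /(mero_continuous mf)/cnbhsP[e e0 h].
    have [w /fE fw /h] := near_E _ e0.
    by rewrite /= fw; apply; exists c.
  have [r r0 hr] := mero_finite mf fz.
  apply: (nEz); have [||d d1 hd] := @identity_principle R (fun w => finpart f w - c) z r r0.
  - by move=> w /hr[_ dw]; exact: cderivableB.
  - move=> e e0; have [w Ew wz] := near_E e e0; exists w; split => //.
      by apply/eqP => wz'; apply: nEz; rewrite -wz'.
    by rewrite /finpart /= (fE _ Ew) subrr.
  exists (Num.min d r); first by rewrite lt_min d1.
  move=> w; rewrite lt_min => /andP[/hd/eqP + /hr[fw _]].
  by rewrite subr_eq0 => /eqP <-; exact: finpartE.
Qed.

Lemma mero_open (f : C -> Chat) a : meromorphic f -> ~ Defs.rational f ->
  f a <> infty R -> forall e : R, 0 < e -> exists2 d : R, 0 < d &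
    forall w, rnorm (w - finpart f a) < d -> exists2 z, rnorm (z - a) < e & f z = fin w.
Proof.
move=> mf nr fa e e0; have [r r0 hr] := mero_finite mf fa.
have [|||d d0 hd] := @open_mapping R (finpart f) a r r0 _ _ (Num.min e r).
- by move=> z /hr[].
- move=> [d d0 hd]; apply: (mero_nonconstant mf nr fa).
  exists (Num.min d r); first by rewrite lt_min d0.
  move=> z; rewrite lt_min => /andP[/hd h /hr[fz _]].
  by rewrite (finpartE fz) (finpartE fa) h.
- by rewrite lt_min e0.
exists d => // w /hd[z]; rewrite lt_min => /andP[ze zr] <-; exists z => //.
by have [fz _] := hr _ zr; exact: finpartE.
Qed.

End Meromorphic.

(** * Dynamics *)

Section Dynamics.
Variable R : realType.
Local Notation C := (cplx R).
Local Notation Chat := (sphere R).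
Implicit Type f : C -> Chat.

Definition sphere_map f (z : Chat) : Chat := if z is Some a then f a else infty R.

Lemma iterateSr f n z : iterate f n.+1 z = iterate f n (sphere_map f z).
Proof. exact: iterSr. Qed.

Lemma fatou_finite f z : Defs.fatou f z -> exists a, z = fin a.
Proof.
(* [iter_dom f 1] says that [iterate f 0 z], which is [z] itself, is not infinity. *)
move=> [D [[_ Dz] /(_ 1%N _ Dz) h _]]; have := h 0%N isT.
by case: z {Dz h} => [a _|/(_ erefl)//]; exists a.
Qed.

Lemma fatou_open f : open (Defs.fatou f).
Proof.
rewrite openE => z [D [[oD Dz] h1 h2]]; rewrite /interior.
by apply: filterS (open_nbhs_nbhs (conj oD Dz)) => w Dw; exists D.
Qed.

(** The image [W] of a small disc is open by [mero_open], and the n-th iterate at [f z] is the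
    (n+1)-st at [z]. A subsequence converging uniformly on a compact square around the disc
    therefore converges uniformly on [W], through a section [h] of [f]. *)
Lemma fatou_forward f a : meromorphic f -> ~ Defs.rational f ->
  Defs.fatou f (fin a) -> Defs.fatou f (f a).
Proof.
move=> mf nr [D [[oD Da] Dit Dn]].
have [e e0 eD] : exists2 e : R, 0 < e & forall z, rnorm (z - a) < e -> D (fin z).
  by apply/cnbhsP; exact: (open_nbhs_nbhs (conj oD Da)).
have ffin z : rnorm (z - a) < e -> f z <> infty R.
  by move=> /eD Dz; exact: (Dit 2%N _ Dz 1%N).
(* The square [Q] of side [2 * r] contains the disc of radius [r], and its points are within
   [4 * r < e] of [a], hence in [D]. *)
pose r := e / 8; have r0 : 0 < r by rewrite divr_gt0.
pose Q := square (a - rc r - ii r) (2 * r).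
have rQ z : rnorm (z - a) < r -> Q z by exact: square_nbhs.
have Qe z : Q z -> rnorm (z - a) < e.
  move=> Qz; have Qa : Q a by apply: rQ; rewrite subrr rnorm0.
  by have := square_rnorm Qz Qa; rewrite /r; lra.
have r_e z : rnorm (z - a) < r -> rnorm (z - a) < e by move=> /rQ/Qe.
pose W : set Chat := [set w | exists2 z, rnorm (z - a) < r & f z = w].
exists W; split.
- split; last by exists a => //; rewrite subrr rnorm0.
  rewrite openE => _ [z zr <-]; rewrite /interior.
  have fz := ffin _ (r_e _ zr).
  have [|d d0 hd] := mero_open mf nr fz (e := r - rnorm (z - a)); first lra.
  rewrite (finpartE fz); apply/cnbhsP; exists d => // w /hd[v vz fv].
  by exists v => //; have := rnorm_triangle z v a; lra.
- move=> n _ [z zr <-] k kn.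
  rewrite -[f z]/(sphere_map f (fin z)) -iterateSr.
  exact: (Dit k.+2 _ (eD _ (r_e _ zr)) k.+1).
- move=> u hu.
  have /choice[m hm] : forall n, exists k, iterate f k = u n.
    by move=> n; have [k _ kn] := hu n; exists k.
  have [|s [g [smono sg]]] := Dn (fun n => iterate f (m n).+1); first by move=> n; exists (m n).+1.
  have /choice[h hh] : forall w : Chat, exists z : C, W w -> rnorm (z - a) < r /\ f z = w.
    move=> w; have [[z zr fz]|nW] := pselect (W w); first by exists z.
    by exists 0.
  exists s, (fun w => g (fin (h w))); split => // K _ KW eps eps0.
  have cQ : compact (@fin R @` Q).
    apply: continuous_compact; last exact: square_compact.
    exact/continuous_subspaceT/fin_continuous.
  have QD : @fin R @` Q `<=` D by move=> _ [z /Qe/eD ? <-].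
  apply: filterS (sg _ cQ QD eps eps0) => n hn w /KW/hh[hr fh].
  rewrite -[X in chordal (u _ X)]fh -hm -[f (h w)]/(sphere_map f (fin (h w))).
  by rewrite -iterateSr; apply: hn; exists (h w) => //; exact: rQ.
Qed.

(** Points of the Fatou set are finite, so discs of the plane serve as connected neighborhoods. *)
Lemma fatou_component_open f U : fatou_component f U -> open U.
Proof.
move=> [z _ ->]; rewrite openE => x zx; rewrite /interior.
have fx := connected_component_sub zx.
have [a xa] := fatou_finite fx; subst x.
rewrite (same_connected_component zx).
have [e e0 he] : exists2 e : R, 0 < e & forall z, rnorm (z - a) < e -> Defs.fatou f (fin z).
  by apply/cnbhsP; exact: (open_nbhs_nbhs (conj (@fatou_open f) fx)).
apply/cnbhsP; exists e => // w wa.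
exists (@fin R @` [set z : C | rnorm (z - a) < e]); last by exists w.
split; first by exists a => //=; rewrite subrr rnorm0.
- by move=> _ [v /he ? <-].
- apply: connected_continuous_connected; first exact: ball_connected.
  exact/continuous_subspaceT/fin_continuous.
Qed.

Lemma sphere_map_component f V x : meromorphic f -> ~ Defs.rational f ->
  fatou_component f V -> V x ->
  fatou_component f (connected_component (Defs.fatou f) (sphere_map f x)) /\
  sphere_map f @` V `<=` connected_component (Defs.fatou f) (sphere_map f x).
Proof.
move=> mf nr [z fz VE] Vx.
have Vf : V `<=` Defs.fatou f by rewrite VE; exact: connected_component_sub.
have sf y : V y -> Defs.fatou f (sphere_map f y).
  by move=> /Vf fy; have [a ya] := fatou_finite fy; subst y; exact: fatou_forward.
split; first by exists (sphere_map f x) => //; exact: sf.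
apply: connected_component_max; first by exists x.
  by move=> _ [y /sf ? <-].
apply: connected_continuous_connected; first by rewrite VE; exact: component_connected.
apply: continuous_in_subspaceT => y; rewrite inE => /Vf/fatou_finite[a ->].
exact: mero_continuous.
Qed.

(** [xget] falls back on the empty set, so a component containing the image of [U] has to be
    exhibited for each [n]. It is the component of the n-th iterate of one fixed point [u] of [U],
    which also identifies the target of the last inclusion. *)
Lemma component_iter_spec f U : meromorphic f -> ~ Defs.rational f ->
  fatou_component f U -> forall n,
  [/\ fatou_component f (component_iter f U n),
      iterate f n @` U `<=` component_iter f U n
    & sphere_map f @` component_iter f U n `<=` component_iter f U n.+1].
Proof.
move=> mf nr fU; have [u Uu] : exists u, U u.
  by have [z fz ->] := fU; exists z; exact: connected_component_refl.
have spec n : (exists V, fatou_component f V /\ iterate f n @` U `<=` V) ->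
    fatou_component f (component_iter f U n) /\
    iterate f n @` U `<=` component_iter f U n.
  by move=> hV; exact: (xgetPex set0 hV).
have step n : fatou_component f (component_iter f U n) /\
    iterate f n @` U `<=` component_iter f U n ->
    fatou_component f (connected_component (Defs.fatou f) (iterate f n.+1 u)) /\
    sphere_map f @` component_iter f U n `<=`
      connected_component (Defs.fatou f) (iterate f n.+1 u).
  move=> [fV UV]; have Vu : component_iter f U n (iterate f n u) by apply: UV; exists u.
  exact: (sphere_map_component mf nr fV Vu).
have it n : fatou_component f (component_iter f U n) /\
    iterate f n @` U `<=` component_iter f U n.
  elim: n => [|n IH]; apply: spec.
    by exists U; split => // _ [z Uz <-].
  have [fV' VV'] := step n IH; exists (connected_component (Defs.fatou f) (iterate f n.+1 u)).
  split => // _ [z Uz <-]; apply: VV'; exists (iterate f n z) => //.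
  by apply: IH.2; exists z.
move=> n; have [h1 h2] := it n; split => //.
have [_] := step n (it n).
have [[z fz VE] hV] := it n.+1.
have : component_iter f U n.+1 (iterate f n.+1 u) by apply: hV; exists u.
by rewrite VE => /same_connected_component ->.
Qed.



End Dynamics.

(** * Excluding Baker wandering domains *)

Section Baker.
Variable R : realType.
Local Notation C := (cplx R).
Local Notation Chat := (sphere R).
Implicit Type f : C -> Chat.

Lemma bounded_rnorm (B : set C) : bounded_set B ->
  exists M : R, forall z, B z -> rnorm z <= M.
Proof.
move=> [M [/complex_realP[m ->] h]]; exists (m + 1) => z Bz.
have : (rc m < rc (m + 1))%R by rewrite ltr_rc ltrDl.
by move=> /h /(_ z Bz) /=; rewrite normE ler_rc.
Qed.

Lemma surrounds0_bounded (V : set Chat) : surrounds0 V ->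
  exists M : R, forall z, connected_component (~` V) (fin 0) z ->
    exists2 w, z = fin w & rnorm w <= M.
Proof.
move=> [_ [B /bounded_rnorm[M hM] ->]]; exists M => _ [w Bw <-].
by exists w => //; exact: hM.
Qed.

Lemma near_infty_norm (U : nat -> set Chat) (M : R) : tends_to_infty U ->
  \forall n \near \oo, forall w, U n (fin w) -> M < rnorm w.
Proof.
move=> /(_ _ (nbhs_infty_norm M)); apply: filterS => n h w Uw.
exact: (h (fin w) Uw).
Qed.

Lemma nearS (P : nat -> Prop) : (\forall n \near \oo, P n) ->
  \forall n \near \oo, P n.+1.
Proof. by move=> [N _ h]; exists N => // n Nn; apply: h => /=; apply: leqW. Qed.

Lemma ray_connected : connected `[0 : R, +oo[.
Proof. by apply/connected_intervalP; exact: interval_is_interval. Qed.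

Lemma segment_from0_avoids (V : set Chat) (z : C) :
  (forall w, V (fin w) -> rnorm z < rnorm w) ->
  @fin R @` ((fun t : R => 0 + rc t * z) @` `[0, 1]) `<=` ~` V.
Proof.
move=> h _ [_ [t /= + <-] <-] /h; rewrite in_itv /= add0r => /andP[t0 t1].
by rewrite rnormM rnorm_rc ger0_norm // ltNge ler_piMl // rnorm_ge0.
Qed.

Lemma baker_asymptotic f w U : meromorphic f -> ~ Defs.rational f ->
  finite_asymptotic_value f w -> ~ baker_wandering f U.
Proof.
move=> mf nr [gam [cgam ginf gw]] [[fU _ _] bU tU].
have spec := component_iter_spec mf nr fU.
have [T hT] : exists T : R, forall t, T < t ->
    exists2 v, f (gam t) = fin v & rnorm (v - w) < 1.
  have : nbhs (fin w) (@fin R @` [set v | rnorm (v - w) < 1]).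
    apply/one_point_compactification_some_nbhs/cnbhsP; by exists 1.
  by move=> /gw[T [_ h]]; exists T => t /h[v vw fv]; exists v.
(* The arc over [[0, T2]] is compact, and [U_n] leaves it as it tends to infinity; beyond [T2] the
   path avoids [U_n] because [U_{n+1}] misses the disc of radius 1 around [w]. *)
pose T2 := Num.max T 0.
have T20 : 0 <= T2 by rewrite le_max lexx orbT.
have TT2 : T <= T2 by rewrite le_max lexx.
have cg : compact (gam @` `[0, T2]).
  apply: continuous_compact; last exact: segment_compact.
  apply: continuous_subspaceW cgam => t /=; rewrite !in_itv /=.
  by case/andP => ->.
near \oo => n.
have [_ _ sn] := spec n.
have hb : surrounds0 (component_iter f U n) by near: n; apply: filterS bU => k [].
have h0 v : component_iter f U n (fin v) -> rnorm (gam 0) < rnorm v.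
  by move: v; near: n; exact: near_infty_norm.
have hc : component_iter f U n `<=` ~` (@fin R @` (gam @` `[0, T2])).
  by near: n; apply: tU; exact: nbhs_infty_compact.
have hw v : component_iter f U n.+1 (fin v) -> rnorm w + 1 < rnorm v.
  by move: v; near: n; exact: nearS (near_infty_norm _ tU).
have [M hM] := surrounds0_bounded hb.
have ng t : 0 <= t -> ~ component_iter f U n (fin (gam t)).
  move=> t0 Vt; have [tT|Tt] := leP t T2.
    by apply: (hc _ Vt); exists (gam t) => //; exists t; rewrite //= in_itv /= t0.
  have [v fv vw] := hT t (le_lt_trans TT2 Tt).
  have /hw : component_iter f U n.+1 (fin v).
    by apply: sn; exists (fin (gam t)).
  by have := rnormBl v w; lra.
(* The segment attaches the path to 0, so that the whole path lies in the bounded component of 0. *)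
pose A := (fun t : R => 0 + rc t * gam 0) @` `[0, 1] `|` gam @` `[0, +oo[.
have cA : connected A.
  apply: connectedU.
  - exists (gam 0); split; last by exists 0; rewrite //= in_itv /= lexx.
    by exists 1; rewrite ?rc1 ?add0r ?mul1r // /= in_itv /= ler01 lexx.
  - exact: segment_path_connected.
  - apply: connected_continuous_connected; [exact: ray_connected|exact: cgam].
have AC : @fin R @` A `<=` connected_component (~` component_iter f U n) (fin 0).
  apply: connected_component_max.
  - exists 0 => //; left; exists 0; last by rewrite rc0 mul0r addr0.
    by rewrite /= in_itv /= ler01 lexx.
  - move=> _ [z [zs|[t /= + <-]] <-].
      by apply: (segment_from0_avoids h0); exists z.
    by rewrite in_itv /= andbT => /ng.
  - apply: connected_continuous_connected; first exact: cA.
    exact/continuous_subspaceT/fin_continuous.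
have [T' [_ hT']] := ginf _ (nbhs_infty_norm M).
pose t := Num.max (T' + 1) 0.
have /hT' : T' < t by rewrite lt_max ltrDl ltr01.
have [|v [<-]] := hM (fin (gam t)).
  apply: AC; exists (gam t) => //; right; exists t => //=.
  by rewrite in_itv /= andbT le_max lexx orbT.
by move=> /= h1 h2; lra.
Unshelve. all: by end_near. Qed.

(* The modulus of [1 / (z - w)] on the sphere, with its value 0 at infinity. *)
Definition inv_dist (w : C) (z : Chat) : R :=
  if z is Some b then (rnorm (b - w))^-1 else 0.

Lemma inv_dist_continuous w z : z <> fin w -> {for z, continuous (inv_dist w)}.
Proof.
case: z => [b|] zw.
  have bw : rnorm (b - w) != 0.
    by rewrite rnorm_eq0 subr_eq0; apply/eqP => bw; apply: zw; rewrite bw.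
  suff cr : {for b, continuous (fun x : C => rnorm (x - w))}.
    have h := @continuousV R C (fun x : C => rnorm (x - w)) b bw cr.
    by move=> P hP; exact: (h P hP).
  move=> P /nbhs_ballP[e /= e0 h]; apply/cnbhsP; exists e => // x xb.
  apply: h => /=.
  apply: le_lt_trans xb.
  have := rnormBl (x - w) (b - w); have := rnormBl (b - w) (x - w).
  rewrite (_ : x - w - (b - w) = x - b); last by ring.
  rewrite (_ : b - w - (x - w) = b - x); last by ring.
  by rewrite (rnormB b x) ler_norml; lra.
move=> P /nbhs_ballP[e /= e0 h].
suff : nbhs (infty R) [set z | `|0 - inv_dist w z| < e].
  by apply: filterS => z; exact: h.
apply: filterS (nbhs_infty_norm (rnorm w + e^-1)) => -[b|] /=.
  move=> hb; have {}h : e^-1 < rnorm (b - w) by have := rnormBl b w; lra.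
  rewrite sub0r normrN ger0_norm ?invr_ge0 ?rnorm_ge0 //.
  rewrite -[ltRHS]invrK ltf_pV2 // posrE ?invr_gt0 //.
  by apply: lt_trans h; rewrite invr_gt0.
by move=> _; rewrite subrr normr0.
Qed.

Lemma baker_omitted f w U : meromorphic f -> ~ Defs.rational f ->
  omitted f (fin w) -> ~ baker_wandering f U.
Proof.
move=> mf nr ow [[fU _ _] bU tU].
have spec := component_iter_spec mf nr fU.
(* Poles are isolated, so 0 or a point near 0 is not a pole; late [U_n] lie outside the circle
   through [z1]. *)
have [z1 fz1] : exists z1, f z1 <> infty R.
  have [f0|f0] := pselect (f 0 = infty R); last by exists 0.
  case: (mf 0) => [/cnbhsP[r r0 h]|[_ /cdnbhsP[r r0 h] _]].
    by exists 0; have [] := h 0; rewrite ?subrr ?rnorm0.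
  exists (rc (r / 2)); apply: (h _ _ _).1.
    by rewrite subr0 rnorm_rc ger0_norm; lra.
  by rewrite -rnorm_eq0 rnorm_rc normr_eq0 gt_eqF // divr_gt0.
pose k := inv_dist w \o sphere_map f.
have kpos z : f z <> infty R -> 0 < k (fin z).
  move=> fz; rewrite /k /= (finpartE fz) /= invr_gt0 rnorm_gt0 subr_eq0.
  by apply/eqP => e; apply: (ow z); rewrite (finpartE fz) e.
near \oo => n.
have [fV _ sn] := spec n.
have hb : surrounds0 (component_iter f U n) by near: n; apply: filterS bU => j [].
have h0 v : component_iter f U n (fin v) -> rnorm z1 < rnorm v.
  by move: v; near: n; exact: near_infty_norm.
(* The margin is chosen so that [1 / |v - w|] is below [k (fin z1)] for all [v] in [U_{n+1}], which
   gives [kV]. *)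
have hw v : component_iter f U n.+1 (fin v) -> rnorm w + (k (fin z1))^-1 < rnorm v.
  by move: v; near: n; exact: nearS (near_infty_norm _ tU).
set V := component_iter f U n in fV sn hb h0.
have [M hM] := surrounds0_bounded hb.
have kV z : V (fin z) -> k (fin z) < k (fin z1).
  move=> Vz; have Vfz : component_iter f U n.+1 (f z) by apply: sn; exists (fin z).
  have kz1 := kpos _ fz1.
  rewrite [X in X < _]/k /=; case: (f z) Vfz => [b /hw hb'|_] //=.
  have h : (k (fin z1))^-1 < rnorm (b - w) by have := rnormBl b w; lra.
  rewrite -[ltRHS]invrK ltf_pV2 // posrE ?invr_gt0 //.
  by apply: lt_trans h; rewrite invr_gt0.
have oV : open V by exact: fatou_component_open fV.
have C1 : connected_component (~` V) (fin 0) (fin z1).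
  apply: (connected_component_max _ (segment_from0_avoids h0)).
  - exists 0 => //; exists 0; last by rewrite rc0 mul0r addr0.
    by rewrite /= in_itv /= ler01 lexx.
  - apply: connected_continuous_connected; first exact: segment_path_connected.
    exact/continuous_subspaceT/fin_continuous.
  - exists z1 => //; exists 1; last by rewrite rc1 mul1r add0r.
    by rewrite /= in_itv /= ler01 lexx.
(* The component of [z1] is that of 0, hence bounded; so a clopen piece separates [z1] from
   infinity. *)
have [||Q [cQ cYQ QY Qz1 Qinf]] := @quasi_component _ (~` V) (fin z1) (infty R)
    (@sphere_hausdorff R) (@sphere_compact R) (open_closedC oV).
- exact: connected_component_sub C1.
- by rewrite -(same_connected_component C1) => /hM[].
have [|||c] := @compact_EVT_max _ R k Q.
- by exists (fin z1).
- exact: (subclosed_compact cQ (@sphere_compact R)).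
- apply: continuous_in_subspaceT => -[z|] /set_mem Qz; last by [].
  apply: (@continuous_comp _ _ _ (sphere_map f) (inv_dist w)).
    exact: mero_continuous.
  by apply: inv_dist_continuous; exact: ow.
rewrite inE; case: c => [c|//] Qc hc.
have kc : k (fin z1) <= k (fin c) by apply: hc; rewrite inE.
have fc : f c <> infty R.
  move=> fc; have := kpos _ fz1; move: kc; rewrite [X in _ <= X]/k /= fc /=; lra.
(* As [Q] is clopen in the complement of [V], near [c] there are only points of [Q], where [k] is at
   most its value at [c], and points of [V], where it is below its value at [z1], which is no
   larger. *)
have oVQ : open (~` (~` V `\` Q)) by exact: closed_openC.
have [e e0 he] : exists2 e : R, 0 < e &
    forall z, rnorm (z - c) < e -> (~` (~` V `\` Q)) (fin z).
  have cVQ : (~` (~` V `\` Q)) (fin c) by move=> -[].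
  by apply/cnbhsP; exact: (open_nbhs_nbhs (conj oVQ cVQ)).
have [d d0 hd] := mero_open mf nr fc e0.
set b := finpart f c in hd.
have bw : 0 < rnorm (b - w).
  by have := kpos _ fc; rewrite /k /= (finpartE fc) /= invr_gt0.
(* Moving the value [b] towards [w] by the fraction [tau] increases [k]; the first bound keeps
   [1 - tau] positive, the second keeps the new value within [d] of [b]. *)
pose tau := Num.min (1 / 2) (d / (2 * rnorm (b - w))).
have t0 : 0 < tau by rewrite lt_min !divr_gt0 // mulr_gt0.
have t1 : tau <= 1 / 2 by rewrite ge_min lexx.
have td : tau * rnorm (b - w) < d.
  have : tau <= d / (2 * rnorm (b - w)) by rewrite ge_min lexx orbT.
  rewrite ler_pdivlMr ?mulr_gt0 // => h; nra.
have [|z zc fz] := hd (b - rc tau * (b - w)).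
  rewrite (_ : b - rc tau * (b - w) - b = - (rc tau * (b - w))); last by ring.
  by rewrite rnormN rnormM rnorm_rc ger0_norm // ltW.
have kz : k (fin c) < k (fin z).
  rewrite /k /= fz (finpartE fc) /= -/b.
  have -> : b - rc tau * (b - w) - w = rc (1 - tau) * (b - w).
    by rewrite rcD rc1 rcN; ring.
  have t1' : 0 < 1 - tau by lra.
  rewrite rnormM rnorm_rc ger0_norm ?(ltW t1') //.
  rewrite ltf_pV2 ?posrE ?mulr_gt0 // gtr_pMl //; lra.
have [Qz|nQz] := pselect (Q (fin z)).
  by have := hc (fin z); rewrite inE => /(_ Qz); lra.
have Vz : V (fin z) by apply: contrapT => nV; exact: (he z zc).
by have := kV z Vz; lra.
Unshelve. all: by end_near. Qed.

End Baker.

Theorem theorem2p19 (R : realType) :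
  (forall f : cplx R -> sphere R,
     classM f -> (exists w : cplx R, finite_asymptotic_value f w) ->
     ~ exists U : set (sphere R), baker_wandering f U) /\
  (forall f : cplx R -> sphere R,
     classMo f -> ~ exists U : set (sphere R), baker_wandering f U).
Proof.
split=> f.
  by move=> [[mf nr] _] [w aw] [U]; exact: (baker_asymptotic mf nr aw).
move=> [[[mf nr] pf] [[w|] ow]] [U]; first exact: (baker_omitted mf nr ow).
(* Infinity is not omitted: both cases of [classM] provide a pole. *)
by case: pf => [[a [b [_ /ow]]]|[a [/(_ a)[_ /(_ erefl)/ow]]]].
Qed.
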